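(* There exist a complex separable infinite-dimensional Hilbert space $H$, a bounded linear operator $T$ on $H$ and a unitary operator $V$ on $H$ such that the following holds: for every non-zero vector $x\in H$, at least one of the two sets $\{T^{n}x : n\ge 0\}$ and $\{T^{n}Vx : n\ge 0\}$ is dense in $H$.
   Context: The orbit of a vector $x$ under the action of $T$ is $\{T^{n}x : n\ge 0\}$. Density is with respect to the norm topology of $H$. *)

(* Defs.v *)
From HB Require Import structures.
From mathcomp Require Import all_boot all_order all_algebra.
From mathcomp Require Import all_classical all_reals all_analysis.
From mathcomp Require Export complex.
Set Implicit Arguments.
Unset Strict Implicit.
Unset Printing Implicit Defensive.
Import Order.TTheory GRing.Theory Num.Theory.
Import numFieldNormedType.Exports.
Local Open Scope classical_set_scope.
Local Open Scope ring_scope.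
Local Open Scope complex_scope.

(* The norm takes its values in the nonnegative reals of R[i]; the inner
   product is linear in its first argument, conjugate-linear in its second. *)
Record hilbertSpace (R : realType) := HilbertSpace {
  hilbert_sort :> completeNormedModType R[i] ;
  inner : {dot hilbert_sort for @Num.conj R[i]} ;
  inner_normE : forall x : hilbert_sort, `|x| ^+ 2 = inner x x }.

Definition separable (T : topologicalType) : Prop :=
  exists D : set T, countable D /\ dense D.

Definition finite_dimensional (K : fieldType) (V : lmodType K) : Prop :=
  exists (n : nat) (e : 'I_n -> V), forall x : V,
    exists c : 'I_n -> K, x = \sum_(i < n) c i *: e i.

(* If V is not 0, any such M is a nonnegative real, since R[i] is ordered by
   z <= w iff w - z is a nonnegative real. *)
Definition bounded_operator (R : realType) (V : normedModType R[i])
    (T : {linear V -> V}) : Prop :=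
  exists M : R[i], forall x : V, `|T x| <= M * `|x|.

Definition is_adjoint (R : realType) (H : hilbertSpace R)
    (T S : {linear H -> H}) : Prop :=
  forall x y : H, inner H (T x) y = inner H x (S y).

Definition unitary_operator (R : realType) (H : hilbertSpace R)
    (V : {linear H -> H}) : Prop :=
  bounded_operator V /\
  exists Vstar : {linear H -> H},
    [/\ is_adjoint V Vstar,
        forall x : H, Vstar (V x) = x &
        forall x : H, V (Vstar x) = x].

Definition orbit_of (X : Type) (T : X -> X) (x : X) : set X :=
  [set iter n T x | n in @setT nat].

(* Main.v *)
(* Let T act on l2 through countably many blocks.  Block n has a finite trunk,
   along which T is a plain shift, and finitely many branches attached to it;
   each branch is a weighted shift of slow exponential growth whose end is sent
   by T to a tiny multiple of a target y supported in the earlier blocks.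
   Everything in the earlier blocks is killed by T^M, where M is the length of
   the trunk.  If a_0, a_1, ... are the coordinates of x on the trunk of block
   n and Q is the polynomial encoding how a branch is attached to the trunk,
   then at the arrival time N of that branch, T^N x is close to A(T) Q(T) y with
   A = a_0 + a_1 X + ...: earlier blocks and branches are already dead, and in
   the later ones T^N is bounded by 3 while x is small there.  As soon as
   |a_0| >= 8^-n, A is invertible modulo X^M with bounded inverse, so a finite
   net of polynomials Q contains one with A(T) Q(T) y close to y.  Hence x is
   hypercyclic unless |a_0| <= 8^-n for all but finitely many n.

   It remains to find a unitary V such that x = 0 whenever both x and V x have
   such negligible trunk coordinates.  V is an infinite product of rotations by
   angles of order 2^-n, the n-th one mixing the first trunk coordinate of block
   n with a coordinate k_n <= n, where each k occurs infinitely often as k_n: it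
   leaves a non-negligible trace of (V x)_k on infinitely many blocks. *)
Require Import Defs.
From HB Require Import structures.
From mathcomp Require Import all_boot all_order all_algebra.
From mathcomp Require Import all_classical all_reals all_analysis.
From mathcomp Require Import ring lra zify.
Set Implicit Arguments.
Unset Strict Implicit.
Unset Printing Implicit Defensive.
Import Order.TTheory GRing.Theory Num.Theory.
Import numFieldNormedType.Exports.
Local Open Scope classical_set_scope.
Local Open Scope ring_scope.
Local Open Scope complex_scope.
Local Notation Re := (@complex.Re _).
Local Notation Im := (@complex.Im _).

(** * The Hilbert space of square-summable complex sequences *)

(** The squared modulus stays in [R], whereas the norm of [R[i]] is valued in [R[i]]; series can
    thus be treated over the reals. *)
Definition sqmod (R : rcfType) (z : R[i]) : R := Re z ^+ 2 + Im z ^+ 2.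
Arguments sqmod {R} z.

Section Sqmod.
Context {R : rcfType}.
Implicit Types z w : R[i].

Lemma sqmod_ge0 z : 0 <= sqmod z.
Proof. by rewrite addr_ge0 ?sqr_ge0. Qed.

Lemma sqmod_eq0 z : sqmod z = 0 -> z = 0.
Proof.
case: z => a b; rewrite /sqmod /= => /eqP.
by rewrite paddr_eq0 ?sqr_ge0// !sqrf_eq0 => /andP[/eqP -> /eqP ->].
Qed.

Lemma sqmodM z w : sqmod (z * w) = sqmod z * sqmod w.
Proof. by case: z w => [a b] [c d]; rewrite /sqmod /=; ring. Qed.

Lemma sqmodN z : sqmod (- z) = sqmod z.
Proof. by case: z => a b; rewrite /sqmod /=; ring. Qed.

Lemma sqmod0 : sqmod (0 : R[i]) = 0.
Proof. by rewrite /sqmod /=; ring. Qed.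

Lemma sqmodD z w : sqmod (z + w) <= 2 * (sqmod z + sqmod w).
Proof.
case: z w => [a b] [c d]; rewrite /sqmod /=.
have := sqr_ge0 (a - c); have := sqr_ge0 (b - d); nra.
Qed.

Lemma Re_conj_mul z w : `|Re (z * w^*)| <= sqmod z + sqmod w.
Proof.
case: z w => [a b] [c d]; rewrite /sqmod /= ler_norml; apply/andP.
have := sqr_ge0 (a - c); have := sqr_ge0 (b - d).
by have := sqr_ge0 (a + c); have := sqr_ge0 (b + d); split; nra.
Qed.

Lemma Im_conj_mul z w : `|Im (z * w^*)| <= sqmod z + sqmod w.
Proof.
case: z w => [a b] [c d]; rewrite /sqmod /= ler_norml; apply/andP.
have := sqr_ge0 (a - d); have := sqr_ge0 (b - c).
by have := sqr_ge0 (a + d); have := sqr_ge0 (b + c); split; nra.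
Qed.

Lemma conj_conjc z : Num.conj z = z^*.
Proof.
have [->|z0] := eqVneq z 0; first by rewrite rmorph0 conjc0.
by apply: (mulfI z0); rewrite -normCK sqr_normc.
Qed.

End Sqmod.

Definition square_summable (R : realType) (x : nat -> R[i]) : Prop :=
  exists M : R, forall n, \sum_(0 <= i < n) sqmod (x i) <= M.

Definition l2_pred (R : realType) : {pred nat -> R[i]} :=
  fun x => `[< square_summable x >].

Section L2pred.
Variable R : realType.

Lemma l2_submod_closed : submod_closed (@l2_pred R).
Proof.
split.
  by apply/asboolP; exists 0 => n; rewrite big1// => i _; rewrite sqmod0.
move=> a x y /asboolP[M xM] /asboolP[N yN]; apply/asboolP.
exists (2 * (sqmod a * M + N)) => n.
apply: (@le_trans _ _ (\sum_(0 <= i < n) 2 * (sqmod a * sqmod (x i) + sqmod (y i)))).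
  apply: ler_sum => i _; rewrite -sqmodM; exact: sqmodD.
rewrite -mulr_sumr big_split/= -mulr_sumr ler_pM2l// lerD//.
by rewrite ler_wpM2l ?sqmod_ge0.
Qed.

HB.instance Definition _ := GRing.isSubmodClosed.Build R[i] (nat -> R[i])
  (@l2_pred R) l2_submod_closed.

End L2pred.

Record l2 (R : realType) : Type :=
  L2 { l2_val :> nat -> R[i]; _ : l2_val \in @l2_pred R }.

HB.instance Definition _ (R : realType) := [isSub for @l2_val R].
HB.instance Definition _ (R : realType) := [Choice of l2 R by <:].
HB.instance Definition _ (R : realType) :=
  [SubChoice_isSubLmodule of l2 R by <:].

Section L2.
Variable R : realType.
Implicit Types (x y : l2 R) (a : R[i]).
Local Notation C := R[i].

Lemma l2_summable x : square_summable x.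
Proof. by case: x => x /= /asboolP. Qed.

Lemma l2P x y : (forall i, x i = y i) -> x = y.
Proof. by move=> xy; apply/val_inj/funext. Qed.

Lemma l2D x y i : (x + y) i = x i + y i. Proof. by []. Qed.
Lemma l2N x i : (- x) i = - x i. Proof. by []. Qed.
Lemma l2B x y i : (x - y) i = x i - y i. Proof. by []. Qed.
Lemma l2Z a x i : (a *: x) i = a * x i. Proof. by []. Qed.
Lemma l20 i : (0 : l2 R) i = 0. Proof. by []. Qed.

Lemma l2_sum I (r : seq I) (P : pred I) (F : I -> l2 R) i :
  (\sum_(k <- r | P k) F k) i = \sum_(k <- r | P k) F k i.
Proof. by elim/big_rec2: _ => // k u v _ <-. Qed.

Definition rsum (u : nat -> R) : R := limn (series u).

Lemma rsumD (u v : nat -> R) : cvgn (series u) -> cvgn (series v) ->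
  rsum (u \+ v) = rsum u + rsum v.
Proof. exact: lim_seriesD. Qed.

Lemma rsumZ (k : R) (u : nat -> R) : cvgn (series u) ->
  rsum (k \*: u) = k * rsum u.
Proof. exact: lim_seriesZ. Qed.

Lemma rsum_lin (a b : R) (u v w : nat -> R) :
  cvgn (series u) -> cvgn (series v) -> cvgn (series w) ->
  rsum ((a \*: u \+ b \*: v) \+ w) = a * rsum u + b * rsum v + rsum w.
Proof.
move=> cu cv cw.
have cau : cvgn (series (a \*: u)) by apply: is_cvg_seriesZ.
have cbv : cvgn (series (b \*: v)) by apply: is_cvg_seriesZ.
rewrite rsumD//; last exact: is_cvg_seriesD.
by rewrite rsumD// !rsumZ.
Qed.

Lemma cvg_series_sqmod x : cvgn (series (sqmod \o x)).
Proof.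
have [M xM] := l2_summable x.
apply: nondecreasing_is_cvgn.
  by apply: nondecreasing_series => i _ _; exact: sqmod_ge0.
by exists M => _ [n _ <-]; exact: xM.
Qed.

Lemma cvg_series_Re x y : cvgn (series (fun i => Re (x i * (y i)^*))).
Proof.
apply: normed_cvg; apply: (@series_le_cvg _ _ ((sqmod \o x) \+ (sqmod \o y))).
- by move=> n; exact: normr_ge0.
- by move=> n; rewrite addr_ge0 ?sqmod_ge0.
- by move=> n; exact: Re_conj_mul.
- by apply: is_cvg_seriesD; exact: cvg_series_sqmod.
Qed.

Lemma cvg_series_Im x y : cvgn (series (fun i => Im (x i * (y i)^*))).
Proof.
apply: normed_cvg; apply: (@series_le_cvg _ _ ((sqmod \o x) \+ (sqmod \o y))).
- by move=> n; exact: normr_ge0.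
- by move=> n; rewrite addr_ge0 ?sqmod_ge0.
- by move=> n; exact: Im_conj_mul.
- by apply: is_cvg_seriesD; exact: cvg_series_sqmod.
Qed.

Definition l2_inner x y : C :=
  rsum (fun i => Re (x i * (y i)^*)) +i* rsum (fun i => Im (x i * (y i)^*)).

Lemma l2_inner_linear_left y : linear_for *%R (l2_inner ^~ y).
Proof.
move=> [a b] u v; rewrite /l2_inner; apply/eqP; rewrite eq_complex/=.
have -> : (fun i => Re (((a +i* b) *: u + v) i * (y i)^*)) =
    (a \*: (fun i => Re (u i * (y i)^*)) \+ (- b) \*: (fun i => Im (u i * (y i)^*)))
    \+ (fun i => Re (v i * (y i)^*)).
  apply/funext => i; rewrite l2D l2Z /=.
  by case: (u i) (v i) (y i) => [? ?] [? ?] [? ?] /=; rewrite /GRing.scale/=; ring.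
have -> : (fun i => Im (((a +i* b) *: u + v) i * (y i)^*)) =
    (a \*: (fun i => Im (u i * (y i)^*)) \+ b \*: (fun i => Re (u i * (y i)^*)))
    \+ (fun i => Im (v i * (y i)^*)).
  apply/funext => i; rewrite l2D l2Z /=.
  by case: (u i) (v i) (y i) => [? ?] [? ?] [? ?] /=; rewrite /GRing.scale/=; ring.
rewrite (rsum_lin a (- b) (@cvg_series_Re u y) (@cvg_series_Im u y)
  (@cvg_series_Re v y)).
rewrite (rsum_lin a b (@cvg_series_Im u y) (@cvg_series_Re u y)
  (@cvg_series_Im v y)).
by rewrite mulNr !eqxx.
Qed.

Lemma l2_innerC x y : l2_inner x y = (l2_inner y x)^*.
Proof.
rewrite /l2_inner /=; congr (_ +i* _).
  congr rsum; apply/funext => i.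
  by case: (x i) (y i) => [? ?] [? ?] /=; ring.
rewrite -mulN1r -rsumZ; last exact: cvg_series_Im.
congr rsum; apply/funext => i /=.
by case: (x i) (y i) => [? ?] [? ?] /=; rewrite /GRing.scale/=; ring.
Qed.

Lemma l2_inner_bilinear :
  bilinear_for (GRing.Scale.Law.clone _ _ *%R _)
    (GRing.Scale.Law.clone _ _ (Num.conj \; *%R) _) l2_inner.
Proof.
split=> [y|x]; first exact: l2_inner_linear_left.
move=> a u v; rewrite l2_innerC l2_inner_linear_left -conj_conjc rmorphD rmorphM /=.
by rewrite (l2_innerC x u) (l2_innerC x v) !conj_conjc.
Qed.

HB.instance Definition _ := bilinear_isBilinear.Build C (l2 R) (l2 R) C _ _
  l2_inner l2_inner_bilinear.

Lemma l2_inner_hermitian x y :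
  l2_inner x y = (-1) ^+ false * Num.conj (l2_inner y x).
Proof. by rewrite mul1r conj_conjc -l2_innerC. Qed.

Lemma l2_innerDl x y z : l2_inner (x + y) z = l2_inner x z + l2_inner y z.
Proof. by have := l2_inner_linear_left z 1 x y; rewrite scale1r mul1r. Qed.

Lemma l2_inner0l y : l2_inner 0 y = 0.
Proof.
have := l2_innerDl 0 0 y; rewrite addr0 => /eqP.
by rewrite -subr_eq0 opprD addrA subrr sub0r oppr_eq0 => /eqP.
Qed.

Lemma l2_innerZl a x y : l2_inner (a *: x) y = a * l2_inner x y.
Proof.
by have := l2_inner_linear_left y a x 0; rewrite !addr0 l2_inner0l addr0.
Qed.

Lemma l2_innerDr x y z : l2_inner x (y + z) = l2_inner x y + l2_inner x z.
Proof. by rewrite l2_innerC l2_innerDl (l2_innerC x y) (l2_innerC x z) rmorphD. Qed.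

Lemma l2_innerZr a x y : l2_inner x (a *: y) = a^* * l2_inner x y.
Proof. by rewrite l2_innerC l2_innerZl (l2_innerC x y) rmorphM. Qed.

HB.instance Definition _ := isHermitianSesquilinear.Build C (l2 R) false
  Num.conj l2_inner l2_inner_hermitian.

Definition sqnorm x : R := rsum (sqmod \o x).

Lemma l2_inner_self x : l2_inner x x = (sqnorm x)%:C.
Proof.
rewrite /l2_inner /sqnorm; congr (_ +i* _).
  congr rsum; apply/funext => i /=; rewrite /sqmod.
  by case: (x i) => ? ? /=; ring.
have -> : (fun i => Im (x i * (x i)^*)) = fun=> 0.
  by apply/funext => i; case: (x i) => ? ? /=; ring.
rewrite /rsum; have -> : series (fun=> 0 : R) = fun=> 0.
  by apply/funext => n; rewrite /series/= big1.
by apply/cvg_lim => //; exact: cvg_cst.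
Qed.

Lemma sum_sqmod_le x n : \sum_(0 <= i < n) sqmod (x i) <= sqnorm x.
Proof.
have nd : nondecreasing_seq (series (sqmod \o x)).
  by apply: nondecreasing_series => i _ _; exact: sqmod_ge0.
exact: nondecreasing_cvgn_le nd (cvg_series_sqmod (x := x)) n.
Qed.

Lemma sqnorm_le x M : (forall n, \sum_(0 <= i < n) sqmod (x i) <= M) ->
  sqnorm x <= M.
Proof.
by move=> xM; apply: limr_le; [exact: cvg_series_sqmod|apply: nearW].
Qed.

Lemma sqmod_le_sqnorm x i : sqmod (x i) <= sqnorm x.
Proof.
apply: le_trans (sum_sqmod_le x i.+1); rewrite big_nat_recr//= lerDr.
by apply: sumr_ge0 => j _; exact: sqmod_ge0.
Qed.

Lemma sqnorm_ge0 x : 0 <= sqnorm x.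
Proof. exact: le_trans (sqmod_ge0 _) (sqmod_le_sqnorm x 0). Qed.

Lemma sqnorm_eq0 x : sqnorm x = 0 -> x = 0.
Proof.
move=> x0; apply: l2P => i; rewrite l20; apply: sqmod_eq0; apply/eqP.
by rewrite eq_le sqmod_ge0 andbT -x0 sqmod_le_sqnorm.
Qed.

Lemma l2_inner_pos x : x != 0 -> 0 < l2_inner x x.
Proof.
move=> x0; rewrite l2_inner_self (ltcR 0) lt_neqAle sqnorm_ge0 andbT eq_sym.
by apply: contra x0 => /eqP/sqnorm_eq0 ->.
Qed.

HB.instance Definition _ := isDotProduct.Build C (l2 R) l2_inner l2_inner_pos.

Definition nrm x : R := Num.sqrt (sqnorm x).

Lemma nrm_ge0 x : 0 <= nrm x. Proof. exact: sqrtr_ge0. Qed.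

Lemma nrm_sqr x : nrm x ^+ 2 = sqnorm x.
Proof. by rewrite sqr_sqrtr ?sqnorm_ge0. Qed.

Lemma sqnormE x : sqnorm x = Re (l2_inner x x).
Proof. by rewrite l2_inner_self. Qed.

Lemma sqnormD x y : sqnorm (x + y) = sqnorm x + 2 * Re (l2_inner x y) + sqnorm y.
Proof.
rewrite !sqnormE l2_innerDl !l2_innerDr [l2_inner y x]l2_innerC.
by case: (l2_inner x x) (l2_inner x y) (l2_inner y y) => [? ?] [? ?] [? ?] /=; ring.
Qed.

Lemma sqnormZ a x : sqnorm (a *: x) = sqmod a * sqnorm x.
Proof.
rewrite /sqnorm -rsumZ; last exact: cvg_series_sqmod.
by congr rsum; apply/funext => i /=; rewrite sqmodM.
Qed.

Lemma nrmZ a x : nrm (a *: x) = Num.sqrt (sqmod a) * nrm x.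
Proof. by rewrite /nrm sqnormZ sqrtrM ?sqmod_ge0. Qed.

Lemma nrm_eq0 x : nrm x = 0 -> x = 0.
Proof. by move=> x0; apply: sqnorm_eq0; rewrite -nrm_sqr x0 expr0n. Qed.

(** Cauchy-Schwarz for the real part: the squared norm of [nrm y *: x - nrm x *: y] equals
    [2 * (A * B) * (A * B - p)], with [A] and [B] the two norms and [p] the real part. *)
Lemma Re_inner_le x y : Re (l2_inner x y) <= nrm x * nrm y.
Proof.
have [->|x0] := eqVneq x 0.
  by rewrite linear0l mulr_ge0 ?nrm_ge0.
have [->|y0] := eqVneq y 0.
  by rewrite linear0r mulr_ge0 ?nrm_ge0.
have nx : 0 < nrm x.
  by rewrite lt_neqAle nrm_ge0 andbT eq_sym; apply: contra x0 => /eqP/nrm_eq0->.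
have ny : 0 < nrm y.
  by rewrite lt_neqAle nrm_ge0 andbT eq_sym; apply: contra y0 => /eqP/nrm_eq0->.
have := sqnorm_ge0 ((nrm y)%:C *: x + (- (nrm x))%:C *: y).
rewrite sqnormD !sqnormZ l2_innerZl l2_innerZr.
have sqmodR (r : R) : sqmod r%:C = r ^+ 2 by rewrite /sqmod/= expr0n addr0.
rewrite !sqmodR -!nrm_sqr.
case: (l2_inner x y) => p q /=.
set A := nrm x in nx *; set B := nrm y in ny *.
have -> : B ^+ 2 * A ^+ 2 + 2 * (B * (- A * p - - 0 * q) - 0 * (- A * q + - 0 * p)) +
   (- A) ^+ 2 * B ^+ 2 = 2 * (A * B) * (A * B - p) by ring.
rewrite pmulr_rge0 ?subr_ge0// ?mulr_gt0//.
Qed.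

Lemma nrmD x y : nrm (x + y) <= nrm x + nrm y.
Proof.
rewrite -(ler_pXn2r (_ : 0 < 2)%N)// ?nnegrE ?addr_ge0 ?nrm_ge0//.
rewrite nrm_sqr sqnormD sqrrD !nrm_sqr lerD2r lerD2l -[leRHS]mulr_natl.
by rewrite ler_pM2l// Re_inner_le.
Qed.

Let cnorm x : C := (nrm x)%:C.

Let cnormD x y : cnorm (x + y) <= cnorm x + cnorm y.
Proof. by rewrite -rmorphD/= lecR nrmD. Qed.

Let cnormZ a x : cnorm (a *: x) = `|a| * cnorm x.
Proof. by rewrite /cnorm nrmZ rmorphM/= normc_def. Qed.

Let cnorm_eq0 x : cnorm x = 0 -> x = 0.
Proof. by move=> /complexI; exact: nrm_eq0. Qed.

HB.instance Definition _ := Lmodule_isNormed.Build C (l2 R)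
  cnormD cnormZ cnorm_eq0.

Lemma l2_normE x : `|x| = (nrm x)%:C. Proof. by []. Qed.


(** For fixed [n] the finite sum is continuous in the coordinates, so a bound valid along [F] passes
    to the coordinatewise limit [l], which need not yet be known to be square-summable. *)
Lemma cvg_coord (F : set_system (l2 R)) (l : nat -> C) :
  ProperFilter F -> (forall i, (fun x : l2 R => Re (x i)) @ F --> Re (l i)) ->
  (forall i, (fun x : l2 R => Im (x i)) @ F --> Im (l i)) ->
  forall x (e : R), (\forall y \near F, nrm (x - y) <= e) ->
  forall n, \sum_(0 <= i < n) sqmod (x i - l i) <= e ^+ 2.
Proof.
move=> FF lR lI x e xe n.
have cv : (fun y : l2 R => \sum_(0 <= i < n) sqmod (x i - y i)) @ F -->
    \sum_(0 <= i < n) sqmod (x i - l i).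
  elim: n => [|n IH].
    by rewrite big_nil; under eq_fun do rewrite big_nil; exact: cvg_cst.
  rewrite big_nat_recr//=; under eq_fun do rewrite big_nat_recr//=.
  apply: cvgD; first exact: IH.
  have E z w : sqmod (z - w) =
      (Re z - Re w) * (Re z - Re w) + (Im z - Im w) * (Im z - Im w).
    by move: z w => [? ?] [? ?]; rewrite /sqmod /= !expr2.
  rewrite (_ : (fun y : l2 R => sqmod (x n - y n)) = fun y : l2 R =>
    (Re (x n) - Re (y n)) * (Re (x n) - Re (y n)) +
    (Im (x n) - Im (y n)) * (Im (x n) - Im (y n))); last first.
    by apply/funext => y; rewrite E.
  rewrite E; apply: cvgD; apply: cvgM; apply: cvgB => //; exact: cvg_cst.
rewrite -(cvg_lim _ cv)//; apply: limr_le; first by apply/cvg_ex; eexists; exact: cv.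
near=> y.
rewrite (le_trans (sum_sqmod_le (x - y) n))// -nrm_sqr.
rewrite ler_pXn2r ?nnegrE ?nrm_ge0//; first by near: y.
apply: (le_trans (nrm_ge0 (x - y))); by near: y.
Unshelve. all: by end_near. Qed.

Lemma Re_coord_le x y i : `|Re (x i) - Re (y i)| <= nrm (x - y).
Proof.
rewrite -(ler_pXn2r (_ : 0 < 2)%N)// ?nnegrE ?nrm_ge0//.
rewrite nrm_sqr (le_trans _ (sqmod_le_sqnorm (x - y) i))// l2B.
by case: (x i) (y i) => [? ?] [? ?]; rewrite /sqmod/= real_normK ?num_real// lerDl sqr_ge0.
Qed.

Lemma Im_coord_le x y i : `|Im (x i) - Im (y i)| <= nrm (x - y).
Proof.
rewrite -(ler_pXn2r (_ : 0 < 2)%N)// ?nnegrE ?nrm_ge0//.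
rewrite nrm_sqr (le_trans _ (sqmod_le_sqnorm (x - y) i))// l2B.
by case: (x i) (y i) => [? ?] [? ?]; rewrite /sqmod/= real_normK ?num_real// lerDr sqr_ge0.
Qed.

Lemma ball_l2E x y (e : R) : ball x e%:C y = (nrm (x - y) < e) :> Prop.
Proof. by rewrite -ball_normE /ball_/= l2_normE ltcR. Qed.

Lemma l2_complete (F : set_system (l2 R)) : ProperFilter F -> cauchy F -> cvg F.
Proof.
move=> FF /cauchyP Fc.
have Fx (e : R) : 0 < e -> exists x, \forall y \near F, nrm (x - y) < e.
  move=> e0; have [|x Fx] := Fc e%:C; first by rewrite (ltcR 0).
  exists x; apply: filterS Fx => y; by rewrite ball_l2E.
have coord (h : C -> R) i :
    (forall x y, `|h (x i) - h (y i)| <= nrm (x - y)) ->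
    cvg ((fun x : l2 R => h (x i)) @ F).
  move=> hle; apply: cauchy_cvg; apply/cauchyP => e e0.
  have [x xe] := Fx _ e0; exists (h (x i)).
  apply: filterS xe => y xy; rewrite /ball/=.
  exact: le_lt_trans (hle _ _) xy.
pose l i : C := lim ((fun x : l2 R => Re (x i)) @ F) +i* lim ((fun x : l2 R => Im (x i)) @ F).
have lR i : (fun x : l2 R => Re (x i)) @ F --> Re (l i).
  by apply: coord => x y; exact: Re_coord_le.
have lI i : (fun x : l2 R => Im (x i)) @ F --> Im (l i).
  by apply: coord => x y; exact: Im_coord_le.
have key x e : (\forall y \near F, nrm (x - y) < e) ->
    forall n, \sum_(0 <= i < n) sqmod (x i - l i) <= e ^+ 2.
  move=> xe; apply: cvg_coord lR lI _ _ _; by apply: filterS xe => y /ltW.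
(* By [key] the difference between [x0] and the coordinatewise limit is square-summable, so the
   limit is recovered as an element of l2 by subtracting that difference from [x0]. *)
have [x0 x0P] := Fx 1 ltr01.
have dP : (fun i => x0 i - l i) \in @l2_pred R.
  by apply/asboolP; exists (1 ^+ 2); exact: key.
pose L := x0 - L2 dP.
have LE i : L i = l i by rewrite l2B/= opprB addrC subrK.
apply/cvg_ex; exists L; apply/(@cvgrPdist_lt _ _ _ F FF id) => e e0.
have eE : e = (Re e)%:C by rewrite RRe_real// gtr0_real.
have e0' : 0 < Re e / 2 by move: e0; rewrite eE (ltcR 0) => e0; rewrite divr_gt0.
have [x xP] := Fx _ e0'.
have xL : nrm (x - L) <= Re e / 2.
  rewrite -(ler_pXn2r (_ : 0 < 2)%N)// ?nnegrE ?nrm_ge0//; last exact: ltW.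
  rewrite nrm_sqr; apply: sqnorm_le => n.
  by under eq_bigr do rewrite l2B LE; exact: key.
near=> y.
rewrite l2_normE eE ltcR /=.
have -> : L - y = (x - y) + (- 1) *: (x - L).
  by rewrite scaleN1r opprB [RHS]addrC subrKA.
apply: (le_lt_trans (nrmD _ _)).
rewrite nrmZ (_ : sqmod (-1) = 1) ?sqrtr1 ?mul1r; last first.
  by rewrite sqmodN /sqmod/=; ring.
rewrite [ltRHS](splitr (Re e)); apply: ltr_leD => //.
by near: y.
Unshelve. all: by end_near. Qed.

HB.instance Definition _ := Uniform_isComplete.Build (l2 R) l2_complete.

Lemma l2_norm_sqr x : `|x| ^+ 2 = l2_inner x x.
Proof. by rewrite l2_inner_self l2_normE -rmorphXn/= nrm_sqr. Qed.

End L2.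

Definition l2_hilbert (R : realType) : hilbertSpace R :=
  @HilbertSpace R (l2 R) (@l2_inner R) (@l2_norm_sqr R).

(** * Basis vectors, restrictions and limits of operators *)

Definition cmod (R : rcfType) (z : R[i]) : R := Num.sqrt (sqmod z).
Arguments cmod {R} z.

Section Cmod.
Context {R : rcfType}.
Implicit Types z w : R[i].

Lemma cmodE z : `|z| = (cmod z)%:C.
Proof. exact: normc_def. Qed.

Lemma cmod_ge0 z : 0 <= cmod z. Proof. exact: sqrtr_ge0. Qed.

Lemma cmodM z w : cmod (z * w) = cmod z * cmod w.
Proof. by rewrite /cmod sqmodM sqrtrM ?sqmod_ge0. Qed.

Lemma cmodD z w : cmod (z + w) <= cmod z + cmod w.
Proof. by rewrite -lecR rmorphD/= -!cmodE ler_normD. Qed.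

Lemma cmodN z : cmod (- z) = cmod z.
Proof. by rewrite /cmod sqmodN. Qed.

Lemma cmodB z w : cmod (z - w) <= cmod z + cmod w.
Proof. by rewrite -(cmodN w) cmodD. Qed.

Lemma cmod0 : cmod (0 : R[i]) = 0.
Proof. by rewrite /cmod sqmod0 sqrtr0. Qed.

Lemma sqmod_real (r : R) : sqmod r%:C = r ^+ 2.
Proof. by rewrite /sqmod/= expr0n addr0. Qed.

Lemma cmod_real (r : R) : cmod r%:C = `|r|.
Proof. by rewrite /cmod sqmod_real sqrtr_sqr. Qed.

Lemma cmod1 : cmod (1 : R[i]) = 1.
Proof. by have := cmod_real 1; rewrite normr1. Qed.

Lemma sqr_cmod z : cmod z ^+ 2 = sqmod z.
Proof. by rewrite sqr_sqrtr ?sqmod_ge0. Qed.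

Lemma cmod_eq0 z : cmod z = 0 -> z = 0.
Proof. by move=> z0; apply: sqmod_eq0; rewrite -sqr_cmod z0 expr0n. Qed.

Lemma cmod_sum I (r : seq I) (P : pred I) (F : I -> R[i]) :
  cmod (\sum_(k <- r | P k) F k) <= \sum_(k <- r | P k) cmod (F k).
Proof.
elim/big_rec2: _ => [|k u v _ uv]; first by rewrite cmod0.
by rewrite (le_trans (cmodD _ _))// lerD2l.
Qed.

Lemma cmod_gt0 z : z != 0 -> 0 < cmod z.
Proof.
move=> z0; rewrite lt_neqAle cmod_ge0 andbT eq_sym.
by apply: contra z0 => /eqP/cmod_eq0 ->.
Qed.

End Cmod.

Section Basis.
Variable R : realType.
Local Notation C := R[i].
Local Notation H := (l2 R).
Implicit Types (x y z : H) (a : C).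

Lemma nrmN x : nrm (- x) = nrm x.
Proof.
by rewrite -scaleN1r nrmZ -[Num.sqrt _]/(cmod _) cmodN cmod1 mul1r.
Qed.

Lemma nrmB x y : nrm (x - y) <= nrm x + nrm y.
Proof. by rewrite -(nrmN y) nrmD. Qed.

Lemma nrmC x y : nrm (x - y) = nrm (y - x).
Proof. by rewrite -nrmN opprB. Qed.

Lemma nrm0 : nrm (0 : H) = 0.
Proof. by rewrite -(scale0r (0 : H)) nrmZ -[Num.sqrt _]/(cmod _) cmod0 mul0r. Qed.

Lemma nrm_scale a x : nrm (a *: x) = cmod a * nrm x.
Proof. exact: nrmZ. Qed.

Lemma nrm_sum I (r : seq I) (P : pred I) (F : I -> H) :
  nrm (\sum_(k <- r | P k) F k) <= \sum_(k <- r | P k) nrm (F k).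
Proof.
elim/big_rec2: _ => [|k u v _ uv]; first by rewrite nrm0.
by rewrite (le_trans (nrmD _ _))// lerD2l.
Qed.

Lemma nrm_sub_trans y x z : nrm (x - z) <= nrm (x - y) + nrm (y - z).
Proof. by rewrite -(subrKA y x) nrmD. Qed.

Lemma cmod_coord_le x i : cmod (x i) <= nrm x.
Proof. by rewrite ler_wsqrtr// sqmod_le_sqnorm. Qed.

Lemma nrm_le x (c : R) : 0 <= c ->
  (forall n, \sum_(0 <= i < n) sqmod (x i) <= c ^+ 2) -> nrm x <= c.
Proof.
move=> c0 xc; rewrite -(ler_pXn2r (_ : 0 < 2)%N) ?nnegrE ?nrm_ge0// nrm_sqr.
exact: sqnorm_le.
Qed.

Lemma sum_uniq_le x (s : seq nat) : uniq s ->
  \sum_(i <- s) sqmod (x i) <= sqnorm x.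
Proof.
move=> us; pose m := (\max_(i <- s) i).+1.
apply: le_trans (sum_sqmod_le x m).
rewrite [leRHS](bigID (mem s) predT) -[X in _ <= X + _]big_filter.
rewrite [X in _ <= X + _](perm_big s); last first.
  apply: uniq_perm; rewrite ?filter_uniq ?iota_uniq// => i.
  rewrite mem_filter mem_index_iota /= andbC; case: (boolP (i \in s)) => //=.
    by move=> si; rewrite ltnS andbT; exact: leq_bigmax_seq.
  by rewrite andbF.
by rewrite lerDl sumr_ge0// => i _; exact: sqmod_ge0.
Qed.

Definition unit_seq (k i : nat) : C := (i == k)%:R.

Lemma unit_seq_l2 k : unit_seq k \in @l2_pred R.
Proof.
apply/asboolP; exists 1 => n.
have [kn|kn] := ltnP k n.
  rewrite (bigD1_seq k) ?mem_index_iota ?iota_uniq//= /unit_seq eqxx.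
  rewrite big1 => [|i /negPf ik]; last by rewrite ik sqmod0.
  by rewrite addr0 /sqmod/=; lra.
rewrite big_nat big1// => i /andP[_ iN].
by rewrite /unit_seq (ltn_eqF (leq_trans iN kn)) sqmod0.
Qed.

Lemma basis_subproof k : {b : H | forall i, b i = (i == k)%:R}.
Proof. by exists (L2 (unit_seq_l2 k)). Qed.

Definition basis k : H := sval (basis_subproof k).

Lemma basisE k i : basis k i = (i == k)%:R.
Proof. exact: (svalP (basis_subproof k)). Qed.

Lemma restrict_l2 (A : pred nat) x : (fun i => if A i then x i else 0) \in @l2_pred R.
Proof.
apply/asboolP; exists (sqnorm x) => n; apply: le_trans (sum_sqmod_le x n).
by apply: ler_sum => i _; case: (A i) => //; rewrite sqmod0 sqmod_ge0.
Qed.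

Lemma restrict_subproof A x : {y : H | forall i, y i = if A i then x i else 0}.
Proof. by exists (L2 (restrict_l2 A x)). Qed.

Definition restrict A x : H := sval (restrict_subproof A x).

Lemma restrictE A x i : restrict A x i = if A i then x i else 0.
Proof. exact: (svalP (restrict_subproof A x)). Qed.

Lemma nrm_restrict_sub (A B : pred nat) x : (forall i, A i -> B i) ->
  nrm (restrict A x) <= nrm (restrict B x).
Proof.
move=> AB; apply: nrm_le (nrm_ge0 _) _ => n; rewrite nrm_sqr.
apply: le_trans (sum_sqmod_le (restrict B x) n).
apply: ler_sum => i _; rewrite !restrictE.
case: (boolP (A i)) => [/AB -> //|_]; first by rewrite sqmod0 sqmod_ge0.
Qed.

Lemma restrict_split (A : pred nat) x :
  x = restrict A x + restrict (predC A) x.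
Proof.
by apply: l2P => i; rewrite l2D !restrictE /=; case: (A i); rewrite ?addr0 ?add0r.
Qed.

Lemma restrict_lt m x : restrict (fun i => (i < m)%N) x = \sum_(i < m) x i *: basis i.
Proof.
apply: l2P => i; rewrite restrictE l2_sum; case: ltnP => im.
  rewrite (bigD1 (Ordinal im) isT) l2Z basisE eqxx mulr1 big1 => [|j ji].
    exact: esym (addr0 _).
  rewrite l2Z basisE; case: eqVneq => [ij|]; rewrite ?mulr0//.
  by case/eqP: ji; exact: val_inj.
rewrite big1// => j _; rewrite l2Z basisE; case: eqVneq => [ij|]; rewrite ?mulr0//.
by move: (ltn_ord j); rewrite -ij ltnNge im.
Qed.

Lemma sum_basis_coord m (f : nat -> C) (g : nat -> nat) i :
  (\sum_(k < m) f k *: basis (g k)) i = \sum_(k < m) f k * (i == g k)%:R.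
Proof. by rewrite l2_sum; apply: eq_bigr => k _; rewrite l2Z basisE. Qed.

Lemma nrm_tail x (e : R) : 0 < e -> exists m0, forall m, (m0 <= m)%N ->
  nrm (restrict (fun i => (m <= i)%N) x) <= e.
Proof.
move=> e0; have e20 : 0 < e ^+ 2 by rewrite exprn_gt0.
have /cvgrPdist_lt/(_ _ e20)[m0 _ xm] := cvg_series_sqmod (x := x).
exists m0 => m mm; apply: nrm_le (ltW e0) _ => n.
have /= := xm _ mm; rewrite ltr_norml => /andP[_].
rewrite -/(rsum _) -/(sqnorm x) ltrBlDr => xme.
rewrite -(lerD2r (\sum_(0 <= i < m) sqmod (x i))); apply: le_trans (ltW xme).
have [nm|mn] := leqP n m.
  rewrite big_nat big1 ?add0r => [|i /andP[_ iN]]; first exact: sum_sqmod_le.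
  by rewrite restrictE leqNgt (leq_trans iN nm)/= sqmod0.
apply: le_trans (sum_sqmod_le x n).
rewrite (big_cat_nat (n := m))//=; last exact: ltnW.
rewrite [X in X + _ + _ <= _]big_nat [X in X + _ + _ <= _]big1 ?add0r; last first.
  by move=> i /andP[_ im]; rewrite restrictE leqNgt im sqmod0.
rewrite addrC [leRHS](big_cat_nat (n := m))//=; last exact: ltnW.
rewrite lerD2l big_nat [leRHS]big_nat; apply: ler_sum => i /andP[mi _].
by rewrite restrictE mi.
Qed.

Lemma l2_inner_basisl x k : l2_inner (basis k) x = (x k)^*.
Proof.
have cvg_eventually (u : nat -> R) v : (forall n, (k < n)%N -> series u n = v) -> rsum u = v.
  move=> uv; apply/cvg_lim => //; apply: cvg_near_cst.
  by exists k.+1 => // n /=; exact: uv.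
have one (u : nat -> R) n : (k < n)%N -> (forall i, i != k -> u i = 0) ->
    series u n = u k.
  move=> kn u0; rewrite /series/= (bigD1_seq k) ?mem_index_iota ?iota_uniq//=.
  by rewrite big1 ?addr0.
rewrite /l2_inner; apply/eqP; rewrite eq_complex/=; apply/andP; split; apply/eqP.
  apply: cvg_eventually => n kn; rewrite one//.
    by rewrite basisE eqxx mul1r.
  by move=> i /negPf ik; rewrite basisE ik mul0r.
apply: cvg_eventually => n kn; rewrite one//.
  by rewrite basisE eqxx mul1r.
by move=> i /negPf ik; rewrite basisE ik mul0r.
Qed.

Lemma l2_inner_basisr x k : l2_inner x (basis k) = x k.
Proof. by rewrite l2_innerC l2_inner_basisl conjcK. Qed.

Lemma nrm_basis k : nrm (basis k) = 1.
Proof.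
by rewrite /nrm sqnormE l2_inner_basisl basisE eqxx conjc1 /= sqrtr1.
Qed.

End Basis.

Section Operators.
Variable R : realType.
Local Notation C := R[i].
Local Notation H := (l2 R).
Implicit Types (x y z : H) (a : C).

Lemma cvg_half (c : R) : (fun n => c * 2^-1 ^+ n) @ \oo --> (0 : R).
Proof.
by apply: cvg_geometric; rewrite ger0_norm ?invr_ge0// invf_lt1 ?ltr1n.
Qed.

Lemma nrm_eq0_geometric x (c : R) : (forall n, nrm x <= c * 2^-1 ^+ n) -> x = 0.
Proof.
move=> xc; apply: nrm_eq0; apply/eqP; rewrite eq_le nrm_ge0 andbT.
rewrite -(cvg_lim _ (cvg_half c))//; apply: limr_ge; last exact: nearW.
by apply/cvg_ex; exists 0; exact: cvg_half.
Qed.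

(** Telescoping bounds the distance from [u n] to [u (n + k)] by
    [2 * c * (2^-1 ^+ n - 2^-1 ^+ (n + k))]; the sequence is Cauchy and the bound survives in the
    limit. *)
Lemma cauchy_geometric (u : nat -> H) (c : R) :
  (forall n, nrm (u n.+1 - u n) <= c * 2^-1 ^+ n) ->
  exists l, forall n, nrm (l - u n) <= 2 * c * 2^-1 ^+ n.
Proof.
move=> uc.
have c0 : 0 <= c by have := uc 0%N; rewrite mulr1; apply: le_trans (nrm_ge0 _).
have step k n : nrm (u (n + k)%N - u n) <= 2 * c * 2^-1 ^+ n - 2 * c * 2^-1 ^+ (n + k).
  elim: k => [|k IH]; first by rewrite addn0 !subrr nrm0.
  rewrite addnS; apply: (le_trans (nrm_sub_trans (u (n + k)%N) _ _)).
  apply: (le_trans (lerD (uc _) IH)).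
  rewrite (exprSr _ (n + k)%N).
  by move: (2^-1 ^+ (n + k)) (2^-1 ^+ n) => t t'; lra.
have steple k n : nrm (u (n + k)%N - u n) <= 2 * c * 2^-1 ^+ n.
  apply: le_trans (step k n) _; rewrite gerBl !mulr_ge0// exprn_ge0// invr_ge0.
have small (e : R) : 0 < e -> exists n, 2 * c * 2^-1 ^+ n < e.
  move=> e0; have /cvgrPdist_lt/(_ _ e0)[n _ /(_ n (leqnn n))] := cvg_half (2 * c).
  by rewrite /= sub0r normrN; exists n; apply: le_lt_trans (ler_norm _) _.
have : cvg (u @ \oo).
  apply: cauchy_cvg; apply/cauchyP => e e0.
  have eE : e = (Re e)%:C by rewrite RRe_real// gtr0_real.
  have [n ne] : exists n, 2 * c * 2^-1 ^+ n < Re e.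
    by apply: small; move: e0; rewrite eE (ltcR 0).
  exists (u n); exists n => // m /= nm; rewrite eE ball_l2E nrmC.
  by rewrite -(subnKC nm); apply: le_lt_trans ne.
move=> /cvg_ex[l /cvgrPdist_lt ul]; exists l => n.
apply/ler_addgt0Pr => e e0.
have [|m _ um] := ul e%:C; first by rewrite (ltcR 0).
have := um _ (leq_addl n m); rewrite /= l2_normE ltcR => /ltW lm.
apply: le_trans (nrm_sub_trans (u (n + m)%N) _ _) _.
by rewrite addrC lerD.
Qed.

Definition pack_linear (f : H -> H) (fl : linear f) : {linear H -> H} :=
  HB.pack f (GRing.isLinear.Build C H H *:%R f fl).

(** Pointwise limits exist by [cauchy_geometric]. The defect of linearity of [g] is at most a
    constant times [2^-1 ^+ n] for every [n], hence zero. *)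
Lemma operator_limit (f : nat -> {linear H -> H}) (c : R) :
  (forall n x, nrm (f n.+1 x - f n x) <= c * 2^-1 ^+ n * nrm x) ->
  exists g : {linear H -> H}, forall n x,
    nrm (g x - f n x) <= 2 * c * 2^-1 ^+ n * nrm x.
Proof.
move=> fc.
have /choice[g gP] : forall x, exists l, forall n,
    nrm (l - f n x) <= 2 * (c * nrm x) * 2^-1 ^+ n.
  by move=> x; apply: cauchy_geometric => n; rewrite mulrAC.
have gl : linear g.
  move=> a x y; apply/eqP; rewrite -subr_eq0; apply/eqP.
  pose K := 2 * (c * nrm (a *: x + y)) + cmod a * (2 * (c * nrm x)) + 2 * (c * nrm y).
  apply: (@nrm_eq0_geometric _ K) => n.
  have -> : g (a *: x + y) - (a *: g x + g y) =
      (g (a *: x + y) - f n (a *: x + y)) - a *: (g x - f n x) - (g y - f n y).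
    rewrite (linearP (f n)); apply: l2P => i.
    by rewrite !(l2D, l2N, l2Z); ring.
  rewrite /K 2!mulrDl; apply: (le_trans (nrmB _ _)); apply: lerD; last exact: gP.
  apply: (le_trans (nrmB _ _)); apply: lerD; first exact: gP.
  by rewrite nrm_scale -mulrA ler_wpM2l ?cmod_ge0.
exists (pack_linear gl) => n x /=.
by rewrite -!mulrA [_ * nrm x]mulrC !mulrA -(mulrA 2); exact: gP.
Qed.

(** Finite combinations of the killed basis vectors are killed, and the remaining tail has
    arbitrarily small image by boundedness. This discards infinitely many coordinates at once. *)
Lemma vanish_restrict (B : {linear H -> H}) (c : R) (A : pred nat) x :
  (forall z, nrm (B z) <= c * nrm z) -> (forall i, A i -> B (basis R i) = 0) ->
  B (restrict A x) = 0.
Proof.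
move=> Bc BA.
have c0 : 0 <= c by have := Bc (basis R 0); rewrite nrm_basis mulr1; apply: le_trans (nrm_ge0 _).
apply: nrm_eq0; apply/eqP; rewrite eq_le nrm_ge0 andbT.
apply/ler_addgt0Pr => e e0; rewrite add0r.
have ec : 0 < e / (c + 1) by rewrite divr_gt0// ltr_wpDl.
have [m /(_ m (leqnn m)) mP] := nrm_tail (restrict A x) ec.
rewrite (restrict_split (fun i => (i < m)%N) (restrict A x)) linearD/= restrict_lt.
rewrite linear_sum big1 ?add0r => [|i _]; last first.
  rewrite linearZ/= restrictE; case: ifP => [/BA ->|]; rewrite ?scaler0 ?scale0r//.
apply: (le_trans (Bc _)).
rewrite (_ : restrict (predC _) _ = restrict (fun i => (m <= i)%N) (restrict A x)); last first.
  by apply: l2P => i; rewrite !restrictE /= -leqNgt.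
apply: le_trans (ler_wpM2l c0 mP) _.
by rewrite mulrCA ger_pMr// ler_pdivrMr ?mul1r ?lerDl// ltr_wpDl.
Qed.

Lemma dense_l2 (S : set (l2_hilbert R)) :
  (forall (y : H) (e : R), 0 < e -> exists2 z : H, S z & nrm (y - z) < e) -> dense S.
Proof.
move=> Sd O [y Oy] Oo.
have : nbhs y O by exact: open_nbhs_nbhs.
move=> /nbhs_ballP[e /= e0 yO].
have eE : e = (Re e)%:C by rewrite RRe_real// gtr0_real.
have [|z Sz yz] := Sd y (Re e); first by move: e0; rewrite eE (ltcR 0).
by exists z; split => //; apply: yO; rewrite eE ball_l2E.
Qed.

End Operators.

(** * Infinite products of rotations *)

Section Rotation.
Variable R : realType.
Local Notation C := R[i].
Local Notation H := (l2 R).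
Implicit Types (x y z : H) (a : C).

Lemma le0_geometric (r c : R) :
  (forall n, exists2 i, (n <= i)%N & r <= c * 2^-1 ^+ i) -> r <= 0.
Proof.
move=> rc; rewrite leNgt; apply/negP => r0.
have /cvgrPdist_lt/(_ _ r0)[n _ nP] := cvg_half c.
have [i ni ri] := rc n.
have := nP i ni; rewrite /= sub0r normrN => /(le_lt_trans (ler_norm _)).
by rewrite ltNge ri.
Qed.

Lemma cmod_le_ReIm (z : C) : cmod z <= `|Re z| + `|Im z|.
Proof.
rewrite -(ler_pXn2r (_ : 0 < 2)%N)// ?nnegrE ?addr_ge0 ?cmod_ge0//.
rewrite sqr_cmod /sqmod sqrrD !real_normK ?num_real// -addrA lerD2l.
by rewrite lerDr mulrn_wge0// mulr_ge0.
Qed.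

(** The real part is bounded by [Re_inner_le], the imaginary part by the same bound for [- 'i *: x].
    The constant 2 is harmless where only convergence to zero is wanted. *)
Lemma Cauchy_Schwarz x y : cmod (l2_inner x y) <= 2 * (nrm x * nrm y).
Proof.
apply: le_trans (cmod_le_ReIm _) _; rewrite mulrDl !mul1r.
have Rle x' : `|Re (l2_inner x' y)| <= nrm x' * nrm y.
  rewrite ler_norml Re_inner_le andbT lerNl.
  have := Re_inner_le (- x') y; rewrite nrmN -scaleN1r l2_innerZl mulN1r.
  by case: (l2_inner x' y).
apply: lerD => //; have := Rle ((- 'i) *: x).
rewrite nrm_scale l2_innerZl cmodN.
have -> : cmod 'i%C = 1 :> R by rewrite /cmod /sqmod/= expr0n add0r expr1n sqrtr1.
rewrite mul1r; case: (l2_inner x y) => p q /=.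
by rewrite oppr0 mul0r sub0r mulNr opprK mul1r.
Qed.

Lemma l2_innerBl x y z : l2_inner (x - y) z = l2_inner x z - l2_inner y z.
Proof. by rewrite l2_innerDl -scaleN1r l2_innerZl mulN1r. Qed.

Lemma l2_innerBr x y z : l2_inner x (y - z) = l2_inner x y - l2_inner x z.
Proof. by rewrite l2_innerC l2_innerBl (l2_innerC x y) (l2_innerC x z) rmorphB. Qed.

(** With [c] and [t] a cosine and a sine, this rotates the plane of coordinates [k] and [s]. Written
    as a perturbation of the identity, it shows its distance from the identity directly. *)
Definition rotation_fun (k s : nat) (c t : R) x : H :=
  x + (((c - 1)%:C * x k - t%:C * x s) *: basis R k +
       (t%:C * x k + (c - 1)%:C * x s) *: basis R s).

Lemma rotation_linear k s c t : linear (rotation_fun k s c t).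
Proof.
by move=> a x y; apply: l2P => i; rewrite /rotation_fun !(l2D, l2Z); ring.
Qed.

Definition rotation k s c t : {linear H -> H} :=
  pack_linear (rotation_linear k s c t).

Lemma rotationE k s c t x : rotation k s c t x = rotation_fun k s c t x.
Proof. by []. Qed.

Lemma rotation_coord k s c t x i : k != s -> rotation k s c t x i =
  if i == k then c%:C * x k - t%:C * x s
  else if i == s then t%:C * x k + c%:C * x s else x i.
Proof.
move=> ks; rewrite rotationE /rotation_fun !(l2D, l2Z) !basisE rmorphB/=.
have [->|ik] := eqVneq i k; first by rewrite (negPf ks) rmorph1 /=; ring.
have [->|is_] := eqVneq i s; first by rewrite rmorph1 /=; ring.
by rewrite !mulr0 !addr0.
Qed.

Lemma rotation_adjoint k s c t x y :
  l2_inner (rotation k s c t x) y = l2_inner x (rotation k s c (- t) y).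
Proof.
rewrite !rotationE /rotation_fun !(l2_innerDl, l2_innerDr, l2_innerZl, l2_innerZr).
rewrite !l2_inner_basisl !l2_inner_basisr; congr (_ + _).
case: (x k) (x s) (y k) (y s) => [a1 a2] [b1 b2] [d1 d2] [e1 e2].
by apply/eqP; rewrite eq_complex/=; apply/andP; split; apply/eqP; ring.
Qed.

Lemma rotationK k s c t x : k != s -> c ^+ 2 + t ^+ 2 = 1 ->
  rotation k s c (- t) (rotation k s c t x) = x.
Proof.
move=> ks ct; apply: l2P => i; rewrite !rotation_coord//.
have ct' : c%:C ^+ 2 + t%:C ^+ 2 = 1 :> C by rewrite -!rmorphXn -rmorphD/= ct.
rewrite !eqxx [s == k]eq_sym (negPf ks) rmorphN/=.
have [->|ik] := eqVneq i k.
  by rewrite -[RHS]mul1r -ct'; ring.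
have [->|//] := eqVneq i s.
by rewrite -[RHS]mul1r -ct'; ring.
Qed.

Lemma nrm_rotation k s c t x : k != s -> c ^+ 2 + t ^+ 2 = 1 ->
  nrm (rotation k s c t x) = nrm x.
Proof.
by move=> ks ct; rewrite /nrm !sqnormE rotation_adjoint rotationK.
Qed.

Lemma nrm_rotation_sub k s c t x :
  nrm (rotation k s c t x - x) <= 2 * (`|c - 1| + `|t|) * nrm x.
Proof.
rewrite rotationE /rotation_fun addrC addKr.
apply: (le_trans (nrmD _ _)); rewrite !nrm_scale !nrm_basis !mulr1.
have h i (r : R) : cmod (r%:C * x i) <= `|r| * nrm x.
  by rewrite cmodM cmod_real ler_wpM2l ?cmod_coord_le.
rewrite -mulrA mulrDl mul1r mulrDl; apply: lerD.
  by apply: le_trans (cmodB _ _) _; apply: lerD; exact: h.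
by apply: le_trans (cmodD _ _) _; rewrite addrC; apply: lerD; exact: h.
Qed.

Section Product.
Variables (kk sg : nat -> nat) (c t : nat -> R).
Hypothesis kk_sg : forall i, kk i != sg i.
Hypothesis ct1 : forall i, c i ^+ 2 + t i ^+ 2 = 1.
Hypothesis ct_small : forall i, 2 * (`|c i - 1| + `|t i|) <= 2^-1 ^+ i.

Fixpoint rotations n : {linear H -> H} :=
  if n is n'.+1 then rotation (kk n') (sg n') (c n') (t n') \o rotations n'
  else idfun.

Fixpoint rotations_inv n : {linear H -> H} :=
  if n is n'.+1 then rotations_inv n' \o rotation (kk n') (sg n') (c n') (- t n')
  else idfun.

Lemma rotationsS n x : rotations n.+1 x =
  rotation (kk n) (sg n) (c n) (t n) (rotations n x).
Proof. by []. Qed.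

Lemma rotations_invS n x : rotations_inv n.+1 x =
  rotations_inv n (rotation (kk n) (sg n) (c n) (- t n) x).
Proof. by []. Qed.

Let ct1N i : c i ^+ 2 + (- t i) ^+ 2 = 1.
Proof. by rewrite sqrrN. Qed.

Lemma nrm_rotations n x : nrm (rotations n x) = nrm x.
Proof. by elim: n => // n IH; rewrite rotationsS nrm_rotation. Qed.

Lemma nrm_rotations_inv n x : nrm (rotations_inv n x) = nrm x.
Proof. by elim: n x => // n IH x; rewrite rotations_invS IH nrm_rotation. Qed.

Lemma rotationsK n x : rotations_inv n (rotations n x) = x.
Proof. by elim: n x => // n IH x; rewrite rotationsS rotations_invS rotationK. Qed.

Lemma rotations_invK n x : rotations n (rotations_inv n x) = x.
Proof.
elim: n x => // n IH x; rewrite rotationsS rotations_invS IH.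
by have := rotationK x (kk_sg n) (ct1N n); rewrite opprK.
Qed.

Lemma rotations_adjoint n x y :
  l2_inner (rotations n x) y = l2_inner x (rotations_inv n y).
Proof. by elim: n x y => // n IH x y; rewrite rotationsS rotation_adjoint IH. Qed.

(** The products and their inverses both converge geometrically, the latter because
    [rotations_inv n] is an isometry. Adjointness and the inverse laws hold exactly at each finite
    stage and pass to the limit with errors of order [2^-1 ^+ n]. *)
Lemma infinite_rotation : exists V W : {linear H -> H},
  [/\ forall n x, nrm (V x - rotations n x) <= 2 * 2^-1 ^+ n * nrm x,
      forall x y, l2_inner (V x) y = l2_inner x (W y),
      forall x, W (V x) = x & forall x, V (W x) = x].
Proof.
have [n x|V VP] := @operator_limit R rotations 1.
  rewrite mul1r rotationsS; apply: (le_trans (nrm_rotation_sub _ _ _ _ _)).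
  by rewrite nrm_rotations ler_wpM2r ?nrm_ge0.
have [n x|W WP] := @operator_limit R rotations_inv 1.
  rewrite mul1r rotations_invS -linearB nrm_rotations_inv.
  apply: (le_trans (nrm_rotation_sub _ _ _ _ _)).
  by rewrite normrN ler_wpM2r ?nrm_ge0.
rewrite mulr1 in VP WP.
exists V, W; split => //.
- move=> x y; apply/eqP; rewrite -subr_eq0; apply/eqP/cmod_eq0.
  apply/eqP; rewrite eq_le cmod_ge0 andbT.
  apply: (@le0_geometric _ (8 * (nrm x * nrm y))) => n; exists n => //.
  have -> : l2_inner (V x) y - l2_inner x (W y) =
      l2_inner (V x - rotations n x) y - l2_inner x (W y - rotations_inv n y).
    by rewrite l2_innerBl l2_innerBr rotations_adjoint; ring.
  apply: (le_trans (cmodB _ _)).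
  apply: (le_trans (lerD (Cauchy_Schwarz _ _) (Cauchy_Schwarz _ _))).
  have := ler_wpM2r (nrm_ge0 y) (VP n x); have := ler_wpM2l (nrm_ge0 x) (WP n y).
  move: (nrm _) (nrm x) (nrm y) (nrm _) (2^-1 ^+ n) => *; nra.
- move=> x; apply/eqP; rewrite -subr_eq0; apply/eqP.
  apply: (@nrm_eq0_geometric _ _ (2 * nrm (V x) + 2 * nrm x)) => n.
  apply: le_trans (nrm_sub_trans (rotations_inv n (V x)) _ _) _.
  rewrite mulrDl; apply: lerD; first by rewrite mulrAC.
  rewrite -{2}(rotationsK n x) -linearB nrm_rotations_inv.
  by rewrite mulrAC.
- move=> x; apply/eqP; rewrite -subr_eq0; apply/eqP.
  apply: (@nrm_eq0_geometric _ _ (2 * nrm (W x) + 2 * nrm x)) => n.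
  apply: le_trans (nrm_sub_trans (rotations n (W x)) _ _) _.
  rewrite mulrDl; apply: lerD; first by rewrite mulrAC.
  rewrite -{2}(rotations_invK n x) -linearB nrm_rotations.
  by rewrite mulrAC.
Qed.

End Product.

End Rotation.

(** * A unitary that never keeps a non-zero negligible vector negligible *)

Section Spread.
Variable R : realType.
Local Notation C := R[i].
Local Notation H := (l2 R).
Implicit Types (x y z : H).
Variables (kk sg : nat -> nat).
Hypothesis kk_le : forall i, (kk i <= i)%N.
Hypothesis sg_gt : forall i, (i < sg i)%N.
Hypothesis sg_inj : injective sg.
Hypothesis kk_often : forall k n, exists2 i, (n <= i)%N & kk i = k.

(** [tau i] is the tangent of half the angle: the rational parametrization of the circle supplies
    [c] and [t]. The shift by 3 makes [8 * tau i] equal to [2^-1 ^+ i], the bound required of the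
    rotations. *)
Let tau i : R := 2^-1 ^+ (i + 3).
Let t i : R := 2 * tau i / (1 + tau i ^+ 2).
Let c i : R := (1 - tau i ^+ 2) / (1 + tau i ^+ 2).

Let tau_gt0 i : 0 < tau i.
Proof. by rewrite exprn_gt0// invr_gt0. Qed.

Let tau_le i : tau i <= 8^-1.
Proof.
rewrite /tau exprD (_ : 2^-1 ^+ 3 = 8^-1 :> R); last by rewrite exprVn -natrX.
by rewrite ler_piMl ?invr_ge0// exprn_ile1 ?invr_ge0// invf_le1 ?ler1n.
Qed.

Let den_gt0 i : 0 < 1 + tau i ^+ 2.
Proof. by rewrite ltr_wpDr// sqr_ge0. Qed.

Let ct1 i : c i ^+ 2 + t i ^+ 2 = 1.
Proof.
rewrite /c /t; have := den_gt0 i; move: (tau i) => u u0.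
by field; rewrite gt_eqF.
Qed.

Let t_le i : t i <= 2 * tau i.
Proof.
by rewrite /t ler_pdivrMr// ler_peMr ?lerDl ?sqr_ge0// mulr_ge0// ltW.
Qed.

Let t_ge i : tau i <= t i.
Proof.
rewrite /t ler_pdivlMr//; have := tau_gt0 i; have := tau_le i.
by move: (tau i) => u; nra.
Qed.

Let c_le1 i : c i <= 1.
Proof.
rewrite /c ler_pdivrMr// mul1r; have := sqr_ge0 (tau i).
by move: (tau i ^+ 2) => u; lra.
Qed.

Let c_ge i : 1 - 2 * tau i <= c i.
Proof.
rewrite /c ler_pdivlMr//; have := tau_gt0 i; have := tau_le i.
by move: (tau i) => u; nra.
Qed.

Let kk_sg i : kk i != sg i.
Proof. by rewrite ltn_eqF// (leq_ltn_trans (kk_le i)). Qed.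

Let ct_small i : 2 * (`|c i - 1| + `|t i|) <= 2^-1 ^+ i.
Proof.
have E : 2^-1 ^+ i = 8 * tau i.
  rewrite /tau exprD (_ : 2^-1 ^+ 3 = 8^-1 :> R); last by rewrite exprVn -natrX.
  by rewrite mulrC mulrVK// unitfE.
rewrite E distrC ger0_norm ?subr_ge0// ger0_norm; last first.
  exact: le_trans (ltW (tau_gt0 i)) (t_ge i).
have := t_le i; have := c_ge i; have := tau_gt0 i; lra.
Qed.

Local Notation rot := (rotations kk sg c t).

(** A rotation of index [l < i] acts on [kk l <= l < sg i] and on [sg l], which differs from [sg i]
    by injectivity. *)
Let rot_sg_before n i x : (n <= i)%N -> rot n x (sg i) = x (sg i).
Proof.
elim: n => [//|n IH] ni; rewrite rotationsS rotation_coord//.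
rewrite ifF; last first.
  apply/negbTE; rewrite gtn_eqF//; apply: leq_ltn_trans (sg_gt i).
  exact: leq_trans (kk_le n) (ltnW ni).
rewrite ifF ?IH//; first exact: ltnW.
by apply/negbTE; apply: contraTN ni => /eqP/sg_inj ->; rewrite ltnn.
Qed.

(** Rotation [j] touches position [sg i] only if [kk j = sg i]; it then mixes in the coordinate
    [sg j], which still has its original value from [x]. *)
Let rot_sg_step j i x (d : R) : (i < j)%N -> cmod (x (sg j)) <= d ->
  cmod (rot j x (sg i)) - 2 * tau j * (cmod (rot j x (sg i)) + d) <=
  cmod (rot j.+1 x (sg i)).
Proof.
move=> ij xd; rewrite rotationsS rotation_coord// (rot_sg_before _ (leqnn j)).
have d0 : 0 <= d by apply: le_trans xd; exact: cmod_ge0.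
have u0 := tau_gt0 j; have := t_le j; have := c_ge j; have := t_ge j.
set a := cmod (rot j x (sg i)); have a0 : 0 <= a by exact: cmod_ge0.
move=> t1 c1 t2.
have t0 : 0 < t j by exact: lt_le_trans u0 t1.
case: eqVneq => [skk|_].
  rewrite -skk.
  have := cmodD (((c j)%:C) * rot j x (sg i) - (t j)%:C * x (sg j)) ((t j)%:C * x (sg j)).
  rewrite subrK !cmodM !cmod_real -/a (ger0_norm (ltW t0)).
  have : c j * a <= `|c j| * a by rewrite ler_wpM2r// ler_norm.
  move: (cmod (x (sg j))) xd (cmod _) => e xd A.
  move: (c j) (t j) (tau j) t1 c1 t2 t0 u0 => cj tj u t1 c1 t2 t0 u0; nra.
case: eqVneq => [/sg_inj ij'|_]; first by rewrite ij' ltnn in ij.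
rewrite -/a; nra.
Qed.

(* The coordinate sg i created at step i is only altered by later rotations with
   pivot sg i, which mix it with negligible coordinates of x. *)
Let rot_sg_after j i x : (forall l, (i < l)%N -> cmod (x (sg l)) <= 8^-1 ^+ i) ->
  (i < j)%N ->
  2^-1 * cmod (rot i.+1 x (sg i)) - 8^-1 ^+ i <= cmod (rot j x (sg i)).
Proof.
move=> xi ij.
(* The losses telescope: since [tau] halves at each step, the loss [2 * tau j] is the decrease of
   [4 * tau j]. The total [4 * tau i.+1] is at most one half because [tau] is at most one eighth. *)
have : (1 - 4 * tau i.+1 + 4 * tau j) * cmod (rot i.+1 x (sg i)) -
    (4 * tau i.+1 - 4 * tau j) * 8^-1 ^+ i <= cmod (rot j x (sg i)).
  elim: j ij => // j IH; rewrite ltnS leq_eqVlt => /predU1P[<-|ij].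
    by rewrite subrK mul1r subrr mul0r subr0.
  have := rot_sg_step ij (xi _ ij); have := IH ij.
  have tj : tau j.+1 = 2^-1 * tau j by rewrite /tau addSn exprS.
  have tij : tau j <= tau i.+1.
    rewrite /tau ler_wiXn2l ?invr_ge0 ?invf_le1 ?ler1n// leq_add2r//.
  have e0 : 0 <= 8^-1 ^+ i :> R by rewrite exprn_ge0// invr_ge0.
  have a0 := cmod_ge0 (rot i.+1 x (sg i)).
  have u0 := tau_gt0 j; have v := tau_le i.+1; rewrite tj.
  move: (cmod (rot i.+1 x (sg i))) (cmod (rot j x (sg i))) a0 => a b a0.
  move: (cmod _) => b'.
  move: (tau j) (tau i.+1) (8^-1 ^+ i) u0 v tij e0 => u w e u0 v tij e0.
  move=> h1 h2.
  have h3 : (1 - 2 * u) * ((1 - 4 * w + 4 * u) * a - (4 * w - 4 * u) * e) <=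
     (1 - 2 * u) * b by rewrite ler_wpM2l//; lra.
  have h4 : 0 <= u * (w - u) * e by rewrite !mulr_ge0// ?subr_ge0// ltW.
  have h5 : 0 <= u * (w - u) * a by rewrite !mulr_ge0// ?subr_ge0// ltW.
  nra.
apply: le_trans.
have e0 : 0 <= 8^-1 ^+ i :> R by rewrite exprn_ge0// invr_ge0.
have a0 := cmod_ge0 (rot i.+1 x (sg i)).
have u0 := tau_gt0 j; have v := tau_le i.+1.
move: (cmod _) a0 (tau j) (tau i.+1) u0 v (8^-1 ^+ i) e0 => a a0 u w u0 v e e0.
nra.
Qed.

Definition negligible x :=
  exists n0, forall n, (n0 <= n)%N -> cmod (x (sg n)) <= 8^-1 ^+ n.

(** Fix [k] and a large [i] with [kk i = k]. Rotation [i] writes [t i] times coordinate [k] of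
    [rot i x] into position [sg i], up to a negligible term, and half of it survives in [V x] up to
    [8^-i]. Negligibility of [x] and [V x] then bounds coordinate [k] of [rot i x] by [40 * 4^-i]:
    the threshold [8^-i] beats the angle of order [2^-i]. That coordinate is within
    [2 * nrm x * 2^-i] of the one of [V x], so the latter is zero. *)
Lemma unitary_spread : exists V W : {linear H -> H},
  [/\ exists M, forall x, nrm (V x) <= M * nrm x,
      forall x y, l2_inner (V x) y = l2_inner x (W y),
      forall x, W (V x) = x, forall x, V (W x) = x &
      forall x, negligible x -> negligible (V x) -> x = 0].
Proof.
have [V [W [Vlim VW WK VK]]] := infinite_rotation kk_sg ct1 ct_small.
exists V, W; split => //.
  exists 3 => x; have := Vlim 0%N x; rewrite expr0 mulr1 /=.
  have := nrmD (V x - x) x; rewrite subrK; lra.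
move=> x [n1 xn] [n2 yn]; rewrite -(WK x).
suff -> : V x = 0 by rewrite linear0.
apply: l2P => k; rewrite l20; apply: cmod_eq0.
apply/eqP; rewrite eq_le cmod_ge0 andbT.
apply: (@le0_geometric _ _ (40 + 2 * nrm x)) => n.
have [i ni ki] := kk_often k (maxn n (maxn n1 n2)); exists i.
  by apply: leq_trans ni; rewrite leq_maxl.
have n1i : (n1 <= i)%N by apply: leq_trans ni; rewrite !leq_max leqnn !orbT.
have n2i : (n2 <= i)%N by apply: leq_trans ni; rewrite !leq_max leqnn !orbT.
have lim j l : cmod (V x l - rot j x l) <= 2 * nrm x * 2^-1 ^+ j.
  by rewrite -l2B mulrAC; apply: le_trans (Vlim j x); exact: cmod_coord_le.
have h8 j : (i <= j)%N -> (8^-1 : R) ^+ j <= 8^-1 ^+ i.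
  by move=> ij; rewrite ler_wiXn2l ?invr_ge0 ?invf_le1 ?ler1n.
have xi l : (i < l)%N -> cmod (x (sg l)) <= 8^-1 ^+ i.
  by move=> il; apply: le_trans (xn _ _) (h8 _ (ltnW il)); apply: leq_trans n1i (ltnW il).
have big : cmod (rot i.+1 x (sg i)) <= 4 * 8^-1 ^+ i.
  suff : 2^-1 * cmod (rot i.+1 x (sg i)) - 2 * 8^-1 ^+ i <= 0.
    by move: (cmod _) (8^-1 ^+ i) => a b; lra.
  apply: (@le0_geometric _ _ (2 * nrm x)) => m; exists (maxn m i.+1).
    by rewrite leq_maxl.
  have := rot_sg_after xi (leq_maxr m i.+1).
  have := lim (maxn m i.+1) (sg i); have := yn _ n2i.
  have := cmodD (V x (sg i) - rot (maxn m i.+1) x (sg i)) (- V x (sg i)).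
  rewrite cmodN addrAC subrr add0r cmodN.
  by move: (cmod _) (cmod _) (cmod _) (cmod _) (8^-1 ^+ i) => *; lra.
have small : cmod (rot i x k) * tau i <= 5 * 8^-1 ^+ i.
  have hs : rot i.+1 x (sg i) = (t i)%:C * rot i x k + (c i)%:C * x (sg i).
    rewrite rotationsS rotation_coord// eq_sym (negPf (kk_sg i)) eqxx ki.
    by rewrite (rot_sg_before _ (leqnn i)).
  have := cmodB (rot i.+1 x (sg i)) ((c i)%:C * x (sg i)).
  rewrite {1}hs addrK !cmodM !cmod_real.
  have t0 : 0 < t i by exact: lt_le_trans (tau_gt0 i) (t_ge i).
  rewrite (ger0_norm (ltW t0)) => h.
  have c1 : `|c i| <= 1.
    rewrite ger0_norm//; apply: le_trans (c_ge i); have := tau_le i; lra.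
  have := ler_wpM2l (cmod_ge0 (rot i x k)) (t_ge i).
  have := xn _ n1i; have := cmod_ge0 (x (sg i)).
  move: big h c1; move: (cmod _) (cmod _) (cmod _) (8^-1 ^+ i) => *; nra.
have E8 : 5 * 8^-1 ^+ i = 40 * 4^-1 ^+ i * tau i :> R.
  rewrite /tau exprD (_ : 2^-1 ^+ 3 = 8^-1 :> R); last by rewrite exprVn -natrX.
  rewrite (_ : 8^-1 = 4^-1 * 2^-1 :> R); last by rewrite -invfM -natrM.
  by rewrite exprMn; field.
rewrite E8 ler_pM2r// in small.
have h42 : (4^-1 : R) ^+ i <= 2^-1 ^+ i.
  by rewrite lerXn2r ?nnegrE ?invr_ge0// lef_pV2 ?posrE// ler_nat.
have := lim i k; have := cmodD (V x k - rot i x k) (rot i x k).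
rewrite subrK; move: small h42; move: (cmod _) (cmod _) (cmod _) (4^-1 ^+ i) (2^-1 ^+ i).
by move=> *; nra.
Qed.

End Spread.

(** * Finite nets and countable dense sets *)

Section Nets.
Variable R : realType.
Local Notation C := R[i].
Local Notation H := (l2 R).

Lemma cmod_le_ReIm2 (z : C) (d : R) : `|Re z| <= d -> `|Im z| <= d -> cmod z <= 2 * d.
Proof.
move=> zr zi; have d0 : 0 <= d by exact: le_trans (normr_ge0 _) zr.
rewrite -(ler_pXn2r (_ : 0 < 2)%N)// ?nnegrE ?cmod_ge0 ?mulr_ge0//.
rewrite sqr_cmod /sqmod -(@real_normK _ (Re z)) ?num_real//.
rewrite -(@real_normK _ (Im z)) ?num_real//.
have := normr_ge0 (Re z); have := normr_ge0 (Im z).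
by move: zr zi; move: `|_| `|_| => *; nra.
Qed.

Lemma real_net (B d : R) : 0 < d ->
  exists s : seq R, forall r, `|r| <= B -> exists2 l, l \in s & `|r - l| <= d.
Proof.
move=> d0; exists [seq - B + k%:R * d | k <- iota 0 (Num.truncn (2 * B / d)).+1].
move=> r; rewrite ler_norml => /andP[Br rB].
have r0 : 0 <= (r + B) / d by rewrite divr_ge0 ?(ltW d0)//; lra.
pose k := Num.truncn ((r + B) / d).
exists (- B + k%:R * d).
  apply: (map_f (fun k : nat => - B + k%:R * d)); rewrite mem_iota /= add0n ltnS.
  by apply: le_truncn; rewrite ler_pM2r ?invr_gt0//; lra.
have := truncn_itv r0; rewrite -/k ler_pdivlMr// ltr_pdivrMr// => /andP[k1 k2].
rewrite ler_norml; rewrite -natr1 mulrDl mul1r in k2.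
by apply/andP; split; lra.
Qed.

Lemma complex_net (B d : R) : 0 < d ->
  exists s : seq C, forall z, cmod z <= B -> exists2 l, l \in s & cmod (z - l) <= d.
Proof.
move=> d0; have [|s sP] := @real_net B (d / 2); first by rewrite divr_gt0.
exists [seq a +i* b | a <- s, b <- s] => -[x y] zB.
have [xB yB] : `|x| <= B /\ `|y| <= B.
  split; apply: le_trans zB; rewrite -(ler_pXn2r (_ : 0 < 2)%N)// ?nnegrE ?cmod_ge0//;
    by rewrite sqr_cmod /sqmod/= real_normK ?num_real// ?lerDl ?lerDr sqr_ge0.
have [a as_ xa] := sP x xB; have [b bs yb] := sP y yB.
exists (a +i* b); first by apply/allpairsP; exists (a, b).
rewrite [leRHS](_ : d = 2 * (d / 2)); last by field.
exact: (@cmod_le_ReIm2 (x +i* y - (a +i* b))).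
Qed.

(* For l < M the sum is the l-th coefficient of the product of the power series
   a and Q j, so that Q j approximates 1/a modulo X^M. *)
Lemma inverse_net (M : nat) (s K e : R) : 0 < s -> 0 < e ->
  exists N (Q : nat -> nat -> C), forall a : nat -> C,
    s <= cmod (a 0%N) -> (forall i, cmod (a i) <= K) ->
    exists2 j, (j < N)%N & forall l, (l < M)%N ->
      cmod (\sum_(i < l.+1) a (l - i)%N * Q j i - (l == 0%N)%:R) <= e.
Proof.
move=> s0 e0; elim: M => [|M [N [Q QP]]].
  by exists 1%N, (fun _ _ => 0) => a _ _; exists 0%N.
(* [B0] bounds the coefficient sum of every [Q j], so the exact next coefficient lies in the ball of
   radius [(1 + |K| * B0) / s], which is covered by [net]. *)
pose B0 := \sum_(j < N) \sum_(i < M) cmod (Q j i).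
have d0 : 0 < e / (`|K| + 1) by rewrite divr_gt0// ltr_wpDl.
have [net netP] := complex_net ((1 + `|K| * B0) / s) d0.
(* Each old [Q j] is extended by each net point as coefficient of degree [M]; the pair is packed
   into one index by division with remainder. *)
pose Q' j i := if i == M then nth 0 net (j %% size net)%N else Q (j %/ size net)%N i.
exists (N * size net)%N, Q' => a sa aK.
have [j jN jP] := QP a sa aK.
have a0 : a 0%N != 0.
  by apply: contraTneq sa => ->; rewrite cmod0 -ltNge.
(* [q] solves the equation of degree [M] exactly. Replacing it by a net point [l] costs
   [a 0 * (q - l)], of modulus at most [K * (e / (|K| + 1)) <= e]. *)
pose q := ((M == 0%N)%:R - \sum_(i < M) a (M - i)%N * Q j i) / a 0%N.
have [l lnet ql] : exists2 l, l \in net & cmod (q - l) <= e / (`|K| + 1).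
  apply: netP; have a00 := cmod_gt0 a0.
  have -> : cmod q = cmod ((M == 0%N)%:R - \sum_(i < M) a (M - i)%N * Q j i) / cmod (a 0%N).
    have <- : q * a 0%N = (M == 0%N)%:R - \sum_(i < M) a (M - i)%N * Q j i.
      by rewrite mulfVK.
    by rewrite (cmodM q) mulfK ?gt_eqF.
  rewrite ler_pdivrMr// mulrAC ler_pdivlMr//.
  apply: ler_pM; rewrite ?cmod_ge0 ?(ltW s0)//.
  apply: (le_trans (cmodB _ _)); apply: lerD.
    by case: (M == 0%N); rewrite ?cmod0// -[X in cmod X]/(1 : C) cmod1.
  apply: (le_trans (cmod_sum _ _ _)).
  rewrite /B0 (bigD1 (Ordinal jN))//= mulrDr; apply: ler_wpDr.
    by rewrite mulr_ge0// !sumr_ge0// => *; rewrite ?sumr_ge0// => *; rewrite ?cmod_ge0.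
  rewrite mulr_sumr; apply: ler_sum => i _; rewrite cmodM ler_wpM2r ?cmod_ge0//.
  exact: le_trans (aK _) (ler_norm _).
have net0 : (0 < size net)%N by case: net lnet {netP Q'}.
have lsz : (index l net < size net)%N by rewrite index_mem.
have dj : ((j * size net + index l net) %/ size net = j)%N.
  by rewrite divnMDl// divn_small// addn0.
have mj : ((j * size net + index l net) %% size net = index l net)%N.
  by rewrite modnMDl modn_small.
exists (j * size net + index l net)%N.
  apply: (@leq_trans (j.+1 * size net)); first by rewrite mulSn addnC ltn_add2r.
  by rewrite leq_mul2r jN orbT.
move=> k; rewrite ltnS leq_eqVlt => /predU1P[->|kM].
  rewrite big_ord_recr/= subnn /Q' eqxx mj nth_index//.
  under eq_bigr => i _ do rewrite ltn_eqF//= dj.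
  have -> : \sum_(i < M) a (M - i)%N * Q j i + a 0%N * l - (M == 0%N)%:R =
      - (a 0%N * (q - l)).
    by rewrite mulrBr /q [a 0%N * (_ / _)]mulrC mulfVK//; ring.
  rewrite cmodN cmodM.
  apply: le_trans (ler_pM (cmod_ge0 _) (cmod_ge0 _) (aK 0%N) ql) _.
  rewrite mulrCA ger_pMr// ler_pdivrMr ?ltr_wpDl// mul1r.
  by have := ler_norm K; lra.
under eq_bigr => i _.
  rewrite /Q' ltn_eqF ?dj; first over.
  exact: leq_trans (ltn_ord i) kM.
exact: jP.
Qed.

Definition rational_vector (w : seq (rat * rat)) : H :=
  \sum_(i < size w) (ratr (nth (0, 0) w i).1 +i* ratr (nth (0, 0) w i).2) *: basis R i.

Lemma rational_vector_coord w i : (size w <= i)%N -> rational_vector w i = 0.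
Proof.
move=> wi; rewrite /rational_vector l2_sum big1// => j _.
rewrite l2Z basisE gtn_eqF ?mulr0//; exact: leq_trans (ltn_ord j) wi.
Qed.

Lemma rational_vector_dense (y : H) (e : R) : 0 < e ->
  exists w, nrm (y - rational_vector w) < e.
Proof.
move=> e0; have e2 : 0 < e / 2 by rewrite divr_gt0.
have [m /(_ m (leqnn m)) ym] := nrm_tail y e2.
pose d := e / (4 * m.+1%:R).
have d0 : 0 < d by rewrite divr_gt0// mulr_gt0.
have approx (r : R) : exists p : rat, `|r - ratr p| <= d / 2.
  have [|p] := @rat_in_itvoo _ (r - d / 2) (r + d / 2); first by lra.
  rewrite in_itv/= => /andP[p1 p2]; exists p; rewrite ler_norml.
  by apply/andP; split; lra.
have /choice[f fP] : forall i, exists p : rat * rat,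
    cmod (y i - (ratr p.1 +i* ratr p.2)) <= d.
  move=> i; have [p pP] := approx (Re (y i)); have [q qP] := approx (Im (y i)).
  exists (p, q); rewrite [leRHS](_ : d = 2 * (d / 2)); last by field.
  by apply: cmod_le_ReIm2; case: (y i) pP qP.
exists (mkseq f m).
rewrite /rational_vector size_mkseq.
rewrite {1}(restrict_split (fun i => (i < m)%N) y) restrict_lt addrAC -sumrB.
apply: (le_lt_trans (nrmD _ _)).
apply: (@le_lt_trans _ _ (m%:R * d + e / 2)); last first.
  rewrite [ltRHS](splitr e) ltrD2r /d mulrA ltr_pdivrMr ?mulr_gt0//.
  rewrite -natr1 (_ : e / 2 * _ = m%:R * e + (m%:R * e + 2 * e)); last by field.
  by rewrite ltrDl ltr_wpDl ?mulr_gt0// mulr_ge0// ltW.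
apply: lerD.
  apply: (le_trans (nrm_sum _ _ _)).
  rewrite mulr_natl -[in leRHS](card_ord m) -sumr_const; apply: ler_sum => i _.
  by rewrite -scalerBl nrm_scale nrm_basis mulr1 nth_mkseq.
apply: le_trans ym; apply: nrm_restrict_sub => i /=; by rewrite -leqNgt.
Qed.

(** The explicit support bound [sz] is needed because a target in block [n] has to be supported in
    the earlier blocks. Codes that decode to nothing yield the zero vector. *)
Lemma dense_finite_sequence : exists (d : nat -> H) (sz : nat -> nat),
  (forall m i, (sz m <= i)%N -> d m i = 0) /\
  forall (y : H) (e : R), 0 < e -> exists m, nrm (y - d m) < e.
Proof.
pose w m : seq (rat * rat) := odflt [::] (unpickle m).
exists (rational_vector \o w), (size \o w); split=> [m i|y e e0].
  exact: rational_vector_coord.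
have [v yv] := rational_vector_dense y e0; exists (pickle v).
by rewrite /= /w pickleK.
Qed.

Lemma l2_separable : separable (l2_hilbert R).
Proof.
have [d [sz [_ dd]]] := dense_finite_sequence.
exists (range d); split; first exact: card_image_le.
apply: dense_l2 => y e e0; have [m ym] := dd y e e0.
by exists (d m) => //; exists m.
Qed.

(** Expressing [n.+1] basis vectors through [n] vectors gives a matrix with a non-zero left kernel,
    hence a non-trivial relation between basis vectors. *)
Lemma l2_infinite_dimensional : ~ finite_dimensional (l2_hilbert R).
Proof.
move=> [n [v vP]].
have /choice[c cP] : forall j, exists c : 'I_n -> C, basis R j = \sum_(i < n) c i *: v i.
  by move=> j; exact: vP.
pose A : 'M[C]_(n.+1, n) := \matrix_(j, i) c j i.
have kA : kermx A != 0.
  by rewrite -mxrank_eq0 mxrank_ker subn_eq0 -ltnNge ltnS rank_leq_col.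
pose r := nz_row (kermx A).
have r0 : r != 0 by rewrite nz_row_eq0.
have rA : r *m A = 0 by apply/sub_kermxP; exact: nz_row_sub.
have sum0 : \sum_(j < n.+1) r 0 j *: basis R j = 0.
  under eq_bigr => j _ do rewrite cP scaler_sumr.
  rewrite exchange_big big1//= => i _.
  under eq_bigr => j _ do rewrite scalerA.
  have rAi : \sum_(j < n.+1) r 0 j * c j i = 0.
    move/matrixP : rA => /(_ 0 i); rewrite mxE [RHS]mxE.
    by under eq_bigr => j _ do rewrite [A j i]mxE.
  by rewrite -scaler_suml rAi scale0r.
case/negP: r0; apply/eqP/rowP => j; rewrite mxE.
have := congr1 (fun x : H => x j) sum0; rewrite l20 l2_sum (bigD1 j isT) => <-.
rewrite l2Z basisE eqxx mulr1 big1 => [|k kj]; first exact: esym (addr0 _).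
rewrite l2Z basisE; case: eqVneq => [jk|]; rewrite ?mulr0//.
by case/eqP: kj; exact/esym/val_inj.
Qed.

End Nets.

(** * The operator *)

Section Coding.

(* The j-th coordinate of the trunk of block n if k = 0, and of its branch number
   k - 1 otherwise.  Indices that are not of this form carry the zero operator. *)
Definition node (n k j : nat) : nat := CodeSeq.code [:: n; k; j].

Definition block (i : nat) : nat := head 0%N (CodeSeq.decode i).

Definition strand (i : nat) : nat := nth 0%N (CodeSeq.decode i) 1.

Lemma decode_node n k j : CodeSeq.decode (node n k j) = [:: n; k; j].
Proof. exact: CodeSeq.codeK. Qed.

Lemma node_eq n k j n' k' j' :
  (node n k j == node n' k' j') = [&& n == n', k == k' & j == j'].
Proof. by rewrite (can_eq CodeSeq.codeK) !eqseq_cons andbT. Qed.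

Lemma block_node n k j : block (node n k j) = n.
Proof. by rewrite /block decode_node. Qed.

Lemma strand_node n k j : strand (node n k j) = k.
Proof. by rewrite /strand decode_node. Qed.

(** It lets index bounds serve as block bounds: late blocks see only the tail of [x], and a support
    below [n] lies in blocks before [n]. It also allows [block] to select the coordinate mixed by
    each rotation. *)
Lemma block_le i : (block i <= i)%N.
Proof.
have := CodeSeq.ltn_code (CodeSeq.decode i); rewrite CodeSeq.decodeK /block.
by case: (CodeSeq.decode i) => //= n s /andP[/ltnW].
Qed.

Lemma nodeP i : (exists n k j, i = node n k j) \/
  (forall n k j, i != node n k j).
Proof.
case E: (CodeSeq.decode i) => [|n [|k [|j [|? ?]]]].
4: by left; exists n, k, j; rewrite /node -E CodeSeq.decodeK.
all: by right=> n' k' j'; apply/eqP => iE; rewrite iE decode_node in E.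
Qed.

End Coding.

(** * Powers of a linear operator *)

Section Powers.
Variable R : realType.
Local Notation H := (l2 R).
Variable T : {linear H -> H}.
Implicit Types x : H.

Fixpoint power n : {linear H -> H} :=
  if n is n'.+1 then T \o power n' else idfun.

Lemma power_iter n x : power n x = iter n T x.
Proof. by elim: n => //= n ->. Qed.

Lemma powerD m n x : power (m + n) x = power m (power n x).
Proof. by rewrite !power_iter iterD. Qed.

Lemma powerSr n x : power n.+1 x = power n (T x).
Proof. by rewrite !power_iter iterSr. Qed.

Lemma powerS n x : power n.+1 x = T (power n x).
Proof. by []. Qed.

Lemma powerZ n (a : R[i]) x : power n (a *: x) = a *: power n x.
Proof. exact: linearZ. Qed.

Lemma nrm_power (C : R) n x : (forall x, nrm (T x) <= C * nrm x) -> 0 <= C ->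
  nrm (power n x) <= C ^+ n * nrm x.
Proof.
move=> TC C0; elim: n => [|n IH]; first by rewrite mul1r.
rewrite powerS exprS -mulrA; apply: le_trans (TC _) _.
by rewrite ler_wpM2l.
Qed.

Lemma power_eq0 m n x : (m <= n)%N -> power m x = 0 -> power n x = 0.
Proof. by move=> mn x0; rewrite -(subnK mn) powerD x0 linear0. Qed.

End Powers.

(** * Weighted shifts along the strands *)

Section Shift.
Variable R : realType.
Local Notation C := R[i].
Local Notation H := (l2 R).
Implicit Types x y z : H.
Variable w : nat -> nat -> nat -> R.
Hypothesis w_le : forall n k j, `|w n k j| <= 2.

Definition shift_coord (x : nat -> C) (i : nat) : C :=
  if CodeSeq.decode i is [:: n; k; j.+1] then (w n k j)%:C * x (node n k j) else 0.

Let pred_node i := if CodeSeq.decode i is [:: n; k; j.+1] then Some (node n k j) else None.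

Let succ_node i := if CodeSeq.decode i is [:: n; k; j] then node n k j.+1 else 0%N.

Let pred_nodeK : ocancel pred_node succ_node.
Proof.
move=> i; rewrite /pred_node /succ_node.
case E: (CodeSeq.decode i) => [|n [|k [|[|j] [|? ?]]]] //=.
by rewrite decode_node /node -E CodeSeq.decodeK.
Qed.

(** Distinct nodes have distinct predecessors, so the sum runs over distinct coordinates of [x].
    Bounding the weights only where [x] is non-zero gives a better constant to vectors supported on
    late strands. *)
Lemma shift_sum_le x (c : R) :
  (forall n k j, x (node n k j) != 0 -> `|w n k j| <= c) -> forall N,
  \sum_(0 <= i < N) sqmod (shift_coord x i) <= c ^+ 2 * sqnorm x.
Proof.
move=> wc N.
have -> : \sum_(0 <= i < N) sqmod (shift_coord x i) =
    \sum_(0 <= i < N | pred_node i) sqmod (shift_coord x i).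
  rewrite [RHS]big_mkcond; apply: eq_bigr => i _; rewrite /shift_coord /pred_node.
  by case: (CodeSeq.decode i) => [|n [|k [|[|j] [|? ?]]]] //=; rewrite sqmod0.
apply: (@le_trans _ _ (\sum_(0 <= i < N | pred_node i)
    c ^+ 2 * sqmod (x (odflt 0%N (pred_node i))))).
  apply: ler_sum => i; rewrite /shift_coord /pred_node.
  case: (CodeSeq.decode i) => [|n [|k [|[|j] [|? ?]]]] //= _.
  have [->|x0] := eqVneq (x (node n k j)) 0; first by rewrite mulr0 sqmod0 mulr0.
  rewrite sqmodM ler_wpM2r ?sqmod_ge0// sqmod_real -real_normK ?num_real//.
  by rewrite ler_pXn2r ?nnegrE ?(le_trans _ (wc _ _ _ x0))// wc.
rewrite -mulr_sumr ler_wpM2l ?sqr_ge0//.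
have := @sum_uniq_le R x (pmap pred_node (index_iota 0 N)).
have -> : \sum_(i <- pmap pred_node (index_iota 0 N)) sqmod (x i) =
    \sum_(0 <= i < N | pred_node i) sqmod (x (odflt 0%N (pred_node i))).
  elim: (index_iota 0 N) => [|i s IH] /=; first by rewrite !big_nil.
  by rewrite big_cons /oapp; case: (pred_node i) => [j|] //=; rewrite big_cons IH.
apply; apply: (pmap_uniq pred_nodeK); exact: iota_uniq.
Qed.

Lemma shift_l2 x : shift_coord x \in @l2_pred R.
Proof.
apply/asboolP; exists (2 ^+ 2 * sqnorm x); exact: shift_sum_le.
Qed.

Lemma shift_subproof x : {y : H | forall i, y i = shift_coord x i}.
Proof. by exists (L2 (shift_l2 x)). Qed.

Definition shift_fun x : H := sval (shift_subproof x).

Lemma shift_funE x i : shift_fun x i = shift_coord x i.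
Proof. exact: (svalP (shift_subproof x)). Qed.

Lemma shift_linear : linear shift_fun.
Proof.
move=> a x y; apply: l2P => i; rewrite l2D l2Z !shift_funE /shift_coord.
case: (CodeSeq.decode i) => [|n [|k [|[|j] [|? ?]]]]; rewrite ?mulr0 ?addr0//.
by rewrite l2D l2Z; ring.
Qed.

Definition shift : {linear H -> H} := pack_linear shift_linear.

Lemma shiftE x i : shift x i = shift_coord x i.
Proof. exact: shift_funE. Qed.

Lemma nrm_shift x (c : R) : 0 <= c ->
  (forall n k j, x (node n k j) != 0 -> `|w n k j| <= c) ->
  nrm (shift x) <= c * nrm x.
Proof.
move=> c0 wc; apply: nrm_le; first by rewrite mulr_ge0// nrm_ge0.
move=> N; rewrite exprMn nrm_sqr.
by under eq_bigr => i _ do rewrite shiftE; exact: shift_sum_le.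
Qed.

Lemma shift_node n k j :
  shift (basis R (node n k j)) = (w n k j)%:C *: basis R (node n k j.+1).
Proof.
apply: l2P => i; rewrite shiftE l2Z basisE /shift_coord.
case E: (CodeSeq.decode i) => [|n' [|k' [|[|j'] [|? ?]]]].
6: rewrite basisE node_eq (_ : i = node n' k' j'.+1) ?node_eq ?eqSS; last by
  rewrite /node -E CodeSeq.decodeK.
6: by case: and3P => [[/eqP -> /eqP -> /eqP ->]|_]; rewrite ?mulr0.
all: case: eqVneq => [iE|]; rewrite ?mulr0//; by rewrite iE decode_node in E.
Qed.

Lemma shift_not_node i : (forall n k j, i != node n k j) -> shift (basis R i) = 0.
Proof.
move=> iN; apply: l2P => i'; rewrite shiftE l20 /shift_coord.
case: (CodeSeq.decode i') => [|n' [|k' [|[|j'] [|? ?]]]] //.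
by rewrite basisE eq_sym (negPf (iN _ _ _)) mulr0.
Qed.

End Shift.

(** * The tree operator and the estimate of its orbits at arrival times *)

Section Tree.
Variable R : realType.
Local Notation C := R[i].
Local Notation H := (l2 R).
Implicit Types x y z : H.
Local Notation e := (basis R).

(** In block [n] the trunk has length [M n] and carries [K n] branches; branch [k] has length
    [L n k], entrance coefficient [c n k], attaching polynomial [q n k] and target [Y n k]. *)
Variables (M K : nat -> nat) (L P : nat -> nat -> nat).
Variables (c : nat -> nat -> R) (q : nat -> nat -> nat -> C) (Y : nat -> nat -> H).

(* P n k exceeds the arrival times of all branches preceding branch k of block
   n, so that at those times the growth along this branch is at most 2. *)
Definition rate n k : R := 1 + (2 * (P n k)%:R)^-1.
(** [tau] measures the junctions of a branch. The power of 2 makes them summable over branches and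
    blocks; the power of 64 outweighs the growth [4 ^+ N] of [T] at arrival times [N] below
    [P n k]. *)
Definition tau n k : R := 2^-1 ^+ (n + k + 3) * 64^-1 ^+ P n k.

Hypothesis M_gt0 : forall n, (0 < M n)%N.
Hypothesis P0 : forall n, P n 0 = M n.
(** Branch [k] arrives at time [L n k + M n], and [P n k.+1] exceeds this by another [M n]. By [MS]
    the next trunk is long enough for the whole present block to die within its length. *)
Hypothesis PS : forall n k, P n k.+1 = (L n k + 2 * M n)%N.
Hypothesis MS : forall n, M n.+1 = P n (K n).
Hypothesis PL : forall n k, (P n k <= L n k)%N.
Hypothesis c_gt0 : forall n k, 0 < c n k.
Hypothesis feed_le : forall n k,
  c n k * \sum_(i < M n) cmod (q n k i) <= tau n k.
Hypothesis Y_block : forall n k i, (n <= block i)%N -> Y n k i = 0.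
(** The growth accumulated along a long enough branch allows a tiny entrance and a tiny exit to
    deliver a target of ordinary size. *)
Hypothesis Y_le : forall n k,
  nrm (Y n k) <= tau n k * (c n k * rate n k ^+ (L n k).-1).

Lemma P_mono n k k' : (k <= k')%N -> (P n k <= P n k')%N.
Proof.
move=> kk; rewrite -(subnK kk); elim: (k' - k)%N => // d IH.
by rewrite addSn PS; apply: leq_trans IH _; apply: leq_trans (PL _ _) (leq_addr _ _).
Qed.

Lemma M_le_P n k : (M n <= P n k)%N.
Proof. by rewrite -P0 P_mono. Qed.

Lemma P_gt0 n k : (0 < P n k)%N.
Proof. exact: leq_trans (M_gt0 n) (M_le_P n k). Qed.

Lemma L_gt0 n k : (0 < L n k)%N.
Proof. exact: leq_trans (P_gt0 n k) (PL n k). Qed.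

Lemma M_mono n n' : (n <= n')%N -> (M n <= M n')%N.
Proof.
move=> nn; rewrite -(subnK nn); elim: (n' - n)%N => // d IH.
by rewrite addSn MS; apply: leq_trans IH (M_le_P _ _).
Qed.

Lemma P_le_M n n' k : (n < n')%N -> (k <= K n)%N -> (P n k <= M n')%N.
Proof.
by move=> nn kK; apply: leq_trans (M_mono nn); rewrite MS P_mono.
Qed.

Lemma rate_ge1 n k : 1 <= rate n k.
Proof. by rewrite lerDl invr_ge0 mulr_ge0. Qed.

Lemma rate_gt0 n k : 0 < rate n k.
Proof. exact: lt_le_trans ltr01 (rate_ge1 n k). Qed.

Lemma rate_le m n k : (0 < m)%N -> (m <= P n k)%N -> rate n k <= 1 + (2 * m%:R)^-1.
Proof.
move=> m0 mP; rewrite lerD2l lef_pV2 ?posrE ?mulr_gt0 ?ltr0n ?P_gt0//.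
by rewrite ler_pM2l// ler_nat.
Qed.

Lemma rate_le2 n k : rate n k <= 2.
Proof.
apply: le_trans (rate_le (m := 1) isT (P_gt0 n k)) _.
by rewrite mulr1 -[leRHS]/(1 + 1) lerD2l invf_le1 ?ler1n.
Qed.

(** The weight is zero from the last node of a strand on, and on all strands beyond the [K n]
    branches: the shift stops there and only the junctions act. *)
Definition weight n k j : R :=
  if k is k'.+1 then if (k' < K n)%N && (j.+1 < L n k')%N then rate n k' else 0
  else if (j.+1 < M n)%N then 1 else 0.

Lemma weight_le n k j : `|weight n k j| <= 2.
Proof.
rewrite /weight; case: k => [|k]; case: ifP => _; rewrite ?normr0 ?normr1 ?ler1n//.
by rewrite gtr0_norm ?rate_gt0// rate_le2.
Qed.

Local Notation S := (shift weight_le).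

(** Normalised so that a branch entered with coefficient [c n k] delivers exactly [Y n k] at its
    end. *)
Definition exit_vector n k : H :=
  ((c n k * rate n k ^+ (L n k).-1)^-1)%:C *: Y n k.

(* The coefficient q n k i is attached i steps before the end of the trunk, hence
   enters the branch with a head start of i powers of T: along the branch, the
   trunk coordinates get convolved with q n k. *)
Definition branch_fun n k x : H :=
  ((c n k)%:C * \sum_(p < M n) q n k (M n - p.+1)%N * x (node n 0 p)) *: e (node n k.+1 0)
  + x (node n k.+1 (L n k).-1) *: exit_vector n k.

Lemma branch_linear n k : linear (branch_fun n k).
Proof.
move=> a x y; rewrite /branch_fun.
have -> : \sum_(p < M n) q n k (M n - p.+1)%N * (a *: x + y) (node n 0 p) =
    a * (\sum_(p < M n) q n k (M n - p.+1)%N * x (node n 0 p)) +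
    \sum_(p < M n) q n k (M n - p.+1)%N * y (node n 0 p).
  rewrite mulr_sumr -big_split; apply: eq_bigr => p _.
  by rewrite l2D l2Z mulrDr mulrCA.
by apply: l2P => i; rewrite !(l2D, l2Z); ring.
Qed.

Definition blocks_fun n (k0 : nat) x : H := \sum_(k < K n | (k0 <= k)%N) branch_fun n k x.

Definition junctions_fun N x : H := \sum_(n < N) blocks_fun n 0 x.

Lemma junctions_linear N : linear (junctions_fun N).
Proof.
move=> a x y; rewrite /junctions_fun scaler_sumr -big_split; apply: eq_bigr => n _.
rewrite /blocks_fun scaler_sumr -big_split; apply: eq_bigr => k _.
exact: branch_linear.
Qed.

Definition junctions N : {linear H -> H} := pack_linear (junctions_linear N).

Lemma tau_ge0 n k : 0 <= tau n k.
Proof. by rewrite mulr_ge0// exprn_ge0// invr_ge0. Qed.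

Lemma nrm_exit n k : nrm (exit_vector n k) <= tau n k.
Proof.
have D0 : 0 < c n k * rate n k ^+ (L n k).-1.
  by rewrite mulr_gt0// exprn_gt0// rate_gt0.
rewrite nrm_scale cmod_real gtr0_norm ?invr_gt0//.
by rewrite mulrC ler_pdivrMr//; exact: Y_le.
Qed.

Lemma nrm_branch n k x : nrm (branch_fun n k x) <= 2 * tau n k * nrm x.
Proof.
rewrite mulrDl mulrDl mul1r; apply: le_trans (nrmD _ _) _; apply: lerD.
  rewrite nrm_scale nrm_basis mulr1 cmodM cmod_real gtr0_norm//.
  apply: le_trans (ler_wpM2r (nrm_ge0 x) (feed_le n k)).
  rewrite -mulrA ler_pM2l// mulr_suml.
  apply: le_trans (cmod_sum _ _ _) _.
  rewrite [leRHS](reindex_inj rev_ord_inj) /=; apply: ler_sum => p _.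
  by rewrite cmodM ler_wpM2l ?cmod_ge0// cmod_coord_le.
rewrite nrm_scale mulrC; apply: ler_pM; rewrite ?nrm_ge0 ?cmod_ge0//.
  exact: nrm_exit.
exact: cmod_coord_le.
Qed.

Lemma sum_half m : \sum_(k < m) 2^-1 ^+ k <= 2 :> R.
Proof.
suff : \sum_(k < m) 2^-1 ^+ k = 2 - 2 * 2^-1 ^+ m :> R.
  by move=> ->; rewrite gerBl mulr_ge0// exprn_ge0// invr_ge0.
elim: m => [|m IH]; first by rewrite big_ord0 mulr1 subrr.
by rewrite big_ord_recr/= IH exprS; move: (2^-1 ^+ m) => u; field.
Qed.

Lemma sum_tau n k0 : \sum_(k < K n | (k0 <= k)%N) 2 * tau n k <=
  2^-1 ^+ n.+1 * 64^-1 ^+ P n k0.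
Proof.
apply: (@le_trans _ _ (\sum_(k < K n)
    (2^-1 ^+ n.+2 * 64^-1 ^+ P n k0) * 2^-1 ^+ k)).
  rewrite big_mkcond/=; apply: ler_sum => k _; case: ifP => [k0k|_]; last first.
    by apply: mulr_ge0; [apply: mulr_ge0|]; rewrite exprn_ge0 ?invr_ge0.
  rewrite /tau mulrA [leRHS]mulrAC; apply: ler_pM.
  - by rewrite mulr_ge0// exprn_ge0// invr_ge0.
  - by rewrite exprn_ge0// invr_ge0.
  - rewrite -exprD (_ : n + k + 3 = (n.+2 + k).+1)%N; last by lia.
    by rewrite exprS mulrA mulfV// mul1r.
  - by rewrite ler_wiXn2l ?invr_ge0 ?invf_le1 ?ler1n// P_mono.
rewrite -mulr_sumr; apply: le_trans (ler_wpM2l _ (sum_half _)) _.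
  by rewrite mulr_ge0// exprn_ge0// invr_ge0.
by rewrite mulrAC exprSr mulfVK.
Qed.

Lemma nrm_blocks n k0 x : nrm (blocks_fun n k0 x) <=
  2^-1 ^+ n.+1 * 64^-1 ^+ P n k0 * nrm x.
Proof.
apply: le_trans (nrm_sum _ _ _) _.
apply: le_trans (ler_wpM2r (nrm_ge0 x) (sum_tau n k0)).
by rewrite mulr_suml; apply: ler_sum => k _; exact: nrm_branch.
Qed.

Lemma junctions_step N x :
  nrm (junctions N.+1 x - junctions N x) <= 1 * 2^-1 ^+ N * nrm x.
Proof.
have -> : junctions N.+1 x - junctions N x = blocks_fun N 0 x.
  rewrite -[junctions N.+1 x]/(junctions_fun N.+1 x) /junctions_fun big_ord_recr/=.
  by rewrite [X in X - _]addrC -/(junctions_fun N x) addrK.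
apply: le_trans (nrm_blocks _ _ _) _; rewrite ler_wpM2r ?nrm_ge0// mul1r exprS.
rewrite mulrAC ler_piMl ?exprn_ge0 ?invr_ge0//.
by rewrite mulr_ile1 ?exprn_ge0 ?invr_ge0 ?exprn_ile1 ?invf_le1 ?ler1n.
Qed.

Section Junctions.
Variable U : {linear H -> H}.
Hypothesis U_lim : forall N x, nrm (U x - junctions N x) <= 2 * 2^-1 ^+ N * nrm x.

Lemma U_le x y (B : R) N0 :
  (forall N, (N0 <= N)%N -> nrm (junctions N x - y) <= B) -> nrm (U x - y) <= B.
Proof.
move=> JB; rewrite -subr_le0; apply: (@le0_geometric _ _ (2 * nrm x)) => N.
exists (maxn N N0); first exact: leq_maxl.
rewrite lerBlDr; apply: le_trans (nrm_sub_trans (junctions (maxn N N0) x) _ _) _.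
by apply: lerD; [rewrite mulrAC; exact: U_lim|exact/JB/leq_maxr].
Qed.

Lemma U_eq x y N0 : (forall N, (N0 <= N)%N -> junctions N x = y) -> U x = y.
Proof.
move=> Jy; apply/eqP; rewrite -subr_eq0; apply/eqP/nrm_eq0.
apply/eqP; rewrite eq_le nrm_ge0 andbT.
by apply: (@U_le _ _ _ N0) => N /Jy ->; rewrite subrr nrm0.
Qed.

Lemma nrm_U_le x m : (forall n, nrm (blocks_fun n 0 x) <= 2^-1 ^+ n.+1 * 64^-1 ^+ m * nrm x) ->
  nrm (U x) <= 64^-1 ^+ m * nrm x.
Proof.
move=> xm; rewrite -(subr0 (U x)); apply: (@U_le _ _ _ 0%N) => N _; rewrite subr0.
apply: le_trans (nrm_sum _ _ _) _.
apply: (@le_trans _ _ (\sum_(n < N) (2^-1 ^+ n.+1 * 64^-1 ^+ m * nrm x))).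
  by apply: ler_sum => n _; exact: xm.
under eq_bigr => n _ do rewrite -mulrA.
rewrite -mulr_suml ler_piMl//; first by rewrite mulr_ge0 ?nrm_ge0// exprn_ge0// invr_ge0.
under eq_bigr => n _ do rewrite exprS.
by rewrite -mulr_sumr -ler_pdivlMl ?invr_gt0// invrK mulr1 sum_half.
Qed.

Lemma nrm_U x : nrm (U x) <= nrm x.
Proof.
have := @nrm_U_le x 0; rewrite mul1r; apply => n.
apply: le_trans (nrm_blocks _ _ _) _; rewrite ler_wpM2r ?nrm_ge0//.
by rewrite mulr1 ler_piMr ?exprn_ge0 ?invr_ge0// exprn_ile1 ?invr_ge0 ?invf_le1 ?ler1n.
Qed.

(** The earlier blocks together with the trunk and the branches up to [k] of block [n]; branch [k]
    is strand [k.+1], since strand 0 is the trunk. *)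
Definition below n k i := (block i < n)%N || ((block i == n) && (strand i <= k.+1)%N).

(** Such a [z] meets only junctions of later branches of block [n] or of later blocks. Monotonicity
    of [P], and [P_le_M] for the later blocks, gives all of them the factor [64^-1 ^+ P n k.+1]. *)
Lemma nrm_U_above n k z : (k < K n)%N -> (forall i, below n k i -> z i = 0) ->
  nrm (U z) <= 64^-1 ^+ P n k.+1 * nrm z.
Proof.
move=> kK z0; apply: nrm_U_le => n'.
have mono m m' : (m <= m')%N -> 2^-1 ^+ n'.+1 * 64^-1 ^+ m' * nrm z <=
    2^-1 ^+ n'.+1 * 64^-1 ^+ m * nrm z.
  move=> mm; rewrite ler_wpM2r ?nrm_ge0// ler_wpM2l ?exprn_ge0 ?invr_ge0//.
  by rewrite ler_wiXn2l ?invr_ge0 ?invf_le1 ?ler1n.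
have rhs0 m : 0 <= 2^-1 ^+ n'.+1 * 64^-1 ^+ m * nrm z.
  by rewrite !mulr_ge0 ?nrm_ge0 ?exprn_ge0 ?invr_ge0.
case: (ltngtP n' n) => [nn|nn|nn].
- rewrite /blocks_fun big1 ?nrm0// => k' _; rewrite /branch_fun big1 => [|p _].
    by rewrite mulr0 scale0r add0r z0 ?scale0r// /below block_node nn.
  by rewrite z0 ?mulr0// /below block_node nn.
- apply: le_trans (nrm_blocks _ _ _) (mono _ _ _).
  by rewrite P0; apply: P_le_M.
- rewrite nn; have -> : blocks_fun n 0 z = blocks_fun n k.+1 z.
    rewrite /blocks_fun [LHS](bigID (fun k' : 'I_(K n) => (k.+1 <= k')%N))/=.
    rewrite [X in _ + X]big1 ?addr0// => k'; rewrite -ltnNge ltnS => k'k.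
    rewrite /branch_fun big1 => [|p _].
      rewrite mulr0 scale0r add0r z0 ?scale0r//.
      by rewrite /below block_node strand_node eqxx ltnS k'k orbT.
    by rewrite z0 ?mulr0// /below block_node strand_node eqxx orbT.
  by have := nrm_blocks n k.+1 z; rewrite -nn.
Qed.

Definition operator_fun x : H := S x + U x.

Lemma operator_linear : linear operator_fun.
Proof.
move=> a x y; rewrite /operator_fun !linearP.
by apply: l2P => i; rewrite !(l2D, l2Z); ring.
Qed.

Definition operator : {linear H -> H} := pack_linear operator_linear.

Local Notation T := operator.

Lemma operatorE x : T x = S x + U x. Proof. by []. Qed.

Lemma nrm_operator x : nrm (T x) <= 4 * nrm x.
Proof.
rewrite operatorE; apply: le_trans (nrmD _ _) _.
have := @nrm_shift _ _ weight_le x 2 _ (fun n k j _ => weight_le n k j).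
by have := nrm_U x; have := nrm_ge0 x; move=> a b h; have {h} := h (ler0n _ 2); lra.
Qed.

Local Notation pw := (power T).

Lemma nrm_pw N x : nrm (pw N x) <= 4 ^+ N * nrm x.
Proof. exact: nrm_power nrm_operator _. Qed.

Lemma U_basis i : U (e i) = blocks_fun (block i) 0 (e i).
Proof.
apply: (@U_eq _ _ (block i).+1) => N iN.
rewrite -[LHS]/(junctions_fun N (e i)) /junctions_fun (bigD1 (Ordinal iN))//=.
rewrite big1 ?addr0// => n /eqP nN; rewrite /blocks_fun big1// => k _.
have ni : (n : nat) != block i by apply/eqP => nE; apply: nN; exact: val_inj.
rewrite /branch_fun big1 => [|p _]; last first.
  rewrite basisE; case: eqP => [iE|]; rewrite ?mulr0//.
  by rewrite -iE block_node eqxx in ni.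
rewrite mulr0 scale0r add0r basisE; case: eqP => [iE|]; rewrite ?scale0r//.
by rewrite -iE block_node eqxx in ni.
Qed.

Definition feed n p : H := \sum_(k < K n)
  ((c n k)%:C * q n k (M n - p.+1)%N) *: e (node n k.+1 0).

Lemma U_trunk n p : U (e (node n 0 p)) = if (p < M n)%N then feed n p else 0.
Proof.
rewrite U_basis block_node /blocks_fun.
transitivity (\sum_(k < K n) ((c n k)%:C * (if (p < M n)%N then q n k (M n - p.+1)%N else 0))
   *: e (node n k.+1 0)); last first.
  by case: ifP => // _; rewrite big1// => k _; rewrite mulr0 scale0r.
apply: eq_bigr => k _; rewrite /branch_fun basisE node_eq andbF scale0r addr0.
congr (_ * _ *: _); case: ifP => pM.
  rewrite (bigD1 (Ordinal pM) isT) basisE eqxx mulr1 big1 => [|p' p'p].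
    exact: addr0.
  rewrite basisE node_eq !eqxx/=; case: eqP => [pE|]; rewrite ?mulr0//.
  by case/eqP: p'p; exact: val_inj.
rewrite big1// => p' _; rewrite basisE node_eq !eqxx/=.
case: eqP => [pE|]; rewrite ?mulr0//.
by rewrite -pE ltn_ord in pM.
Qed.

Lemma U_branch n k j : U (e (node n k.+1 j)) =
  if (k < K n)%N && (j == (L n k).-1) then exit_vector n k else 0.
Proof.
rewrite U_basis block_node /blocks_fun.
have E (k' : 'I_(K n)) : branch_fun n k' (e (node n k.+1 j)) =
    if (k' == k :> nat) && (j == (L n k).-1) then exit_vector n k else 0.
  rewrite /branch_fun big1 => [|p _]; last by rewrite basisE node_eq andbF mulr0.
  rewrite mulr0 scale0r add0r basisE node_eq eqxx/= eqSS.
  case: eqP => [->|_]; rewrite ?scale0r//= eq_sym.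
  by case: eqP; rewrite ?scale1r ?scale0r.
under eq_bigr => k' _ do rewrite E.
case: (ltnP k (K n)) => kK /=.
  rewrite (bigD1 (Ordinal kK) isT) /= eqxx big1 => [|k' k'k]; first by rewrite addr0.
  rewrite ifF//; apply/negbTE; rewrite negb_and; apply/orP; left.
  by apply: contra k'k => /eqP kE; apply/eqP/val_inj.
by rewrite big1// => k' _; rewrite ltn_eqF// (leq_trans _ kK).
Qed.

Lemma U_not_node i : (forall n k j, i != node n k j) -> U (e i) = 0.
Proof.
move=> iN; rewrite U_basis /blocks_fun big1// => k _; rewrite /branch_fun.
rewrite big1 => [|p _]; last by rewrite basisE eq_sym (negPf (iN _ _ _)) mulr0.
by rewrite mulr0 scale0r add0r basisE eq_sym (negPf (iN _ _ _)) scale0r.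
Qed.

(** The value 0 beyond the trunk makes the recursion [T_trunk] uniform up to the last node. *)
Definition trunk n p : H := if (p < M n)%N then e (node n 0 p) else 0.

Lemma T_trunk n p : (p < M n)%N -> T (trunk n p) = trunk n p.+1 + feed n p.
Proof.
move=> pM; rewrite /trunk pM operatorE shift_node U_trunk pM /weight.
by case: ifP => _; rewrite ?scale1r ?scale0r.
Qed.

Lemma T_branch n k j : (k < K n)%N -> (j.+1 < L n k)%N ->
  T (e (node n k.+1 j)) = (rate n k)%:C *: e (node n k.+1 j.+1).
Proof.
move=> kK jL; rewrite operatorE shift_node U_branch /weight kK jL /= ifF ?addr0//.
by apply/negbTE/eqP; lia.
Qed.

Lemma T_exit n k : (k < K n)%N -> T (e (node n k.+1 (L n k).-1)) = exit_vector n k.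
Proof.
move=> kK; rewrite operatorE shift_node U_branch /weight kK eqxx /= prednK ?L_gt0//.
by rewrite ltnn scale0r add0r.
Qed.

Definition active i := exists n k j, i = node n k j /\
  if k is k'.+1 then (k' < K n)%N && (j < L n k')%N else (j < M n)%N.

Lemma T_inactive i : ~ active i -> T (e i) = 0.
Proof.
move=> iA; rewrite operatorE; have [[n [[|k] [j iE]]]|iN] := nodeP i; last first.
- by rewrite shift_not_node// U_not_node// addr0.
- have h : ((k < K n)%N && (j < L n k)%N) = false.
    by apply/negP => h; apply: iA; exists n, k.+1, j.
  rewrite iE shift_node U_branch /weight.
  rewrite !ifF ?scale0r ?addr0//; apply/negP => /andP[kK].
    by move=> /eqP jE; move: h; rewrite kK jE prednK ?L_gt0 ?leqnn.
  by move=> jL; move: h; rewrite kK (ltnW jL).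
- have h : (j < M n)%N = false by apply/negP => h; apply: iA; exists n, 0%N, j.
  rewrite iE shift_node U_trunk h /weight ifF ?scale0r ?addr0//.
  by apply/negP => /ltnW; rewrite h.
Qed.

Lemma branch_out n k s : (k < K n)%N -> (s < L n k)%N ->
  pw s.+1 (e (node n k.+1 ((L n k).-1 - s)%N)) = ((rate n k) ^+ s)%:C *: exit_vector n k.
Proof.
move=> kK; elim: s => [|s IH] sL.
  by rewrite subn0 -[pw 1 _]/(T _) T_exit// scale1r.
rewrite powerSr T_branch//; last by lia.
rewrite powerZ (_ : ((L n k).-1 - s.+1).+1 = (L n k).-1 - s)%N; last by lia.
by rewrite (IH (ltnW sL)) scalerA -rmorphM -exprS.
Qed.

Lemma branch_full n k : (k < K n)%N ->
  pw (L n k) (e (node n k.+1 0)) = ((c n k)^-1)%:C *: Y n k.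
Proof.
move=> kK; have L0 := L_gt0 n k.
have := @branch_out n k (L n k).-1 kK; rewrite prednK// subnn => ->//.
rewrite /exit_vector scalerA -rmorphM/=; congr (_%:C *: _).
have r0 : rate n k ^+ (L n k).-1 != 0 by rewrite gt_eqF// exprn_gt0// rate_gt0.
have c0 : c n k != 0 by rewrite gt_eqF.
by rewrite invfM mulrC -mulrA mulVf ?mulr1.
Qed.

(** Unrolling [T_trunk]: the vector moves to the end of the trunk in [s] steps, feeding the branches
    at each. What is fed [i] nodes before the last one has [N - s + i] powers of [T] left. *)
Lemma trunk_out n s N : (s <= M n)%N -> (s <= N)%N ->
  pw N (trunk n (M n - s)%N) =
  \sum_(i < s) pw (N - s + i)%N (feed n (M n - i.+1)%N).
Proof.
elim: s N => [|s IH] N sM sN.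
  by rewrite subn0 /trunk ltnn linear0 big_ord0.
case: N sN => // N; rewrite ltnS => sN.
rewrite powerSr T_trunk; last by lia.
rewrite (_ : (M n - s.+1).+1 = M n - s)%N; last by lia.
have sM' := ltnW sM; rewrite linearD IH// [RHS]big_ord_recr subSS /= subnK//.
Qed.

Definition nilpotent_below n := forall i, (block i < n)%N -> pw (M n) (e i) = 0.

Lemma nilpotent_target n k : nilpotent_below n -> pw (M n) (Y n k) = 0.
Proof.
move=> nb; have -> : Y n k = restrict (fun i => (block i < n)%N) (Y n k).
  by apply: l2P => i; rewrite restrictE; case: ltnP => // /Y_block.
by apply: vanish_restrict (nrm_pw (M n)) _ => i; exact: nb.
Qed.

(** Within [L n k] steps a branch node becomes a multiple of [Y n k], which lies in the earlier
    blocks and dies in [M n] more; a node beyond the branch is killed at once. *)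
Lemma branch_nilpotent n k j N : nilpotent_below n -> (k < K n)%N ->
  (L n k + M n <= N)%N -> pw N (e (node n k.+1 j)) = 0.
Proof.
move=> nb kK LN; have [jL|Lj] := ltnP j (L n k).
  have := @branch_out n k ((L n k).-1 - j) kK.
  rewrite (_ : ((L n k).-1 - ((L n k).-1 - j) = j)%N); last by lia.
  move=> /(_ ltac:(lia)) jE.
  apply: (@power_eq0 _ _ (M n + ((L n k).-1 - j).+1)%N); first by lia.
  rewrite powerD jE powerZ /exit_vector powerZ.
  by rewrite nilpotent_target// !scaler0.
apply: (@power_eq0 _ _ 1%N); first by have := L_gt0 n k; lia.
rewrite -[pw 1 _]/(T _) T_inactive// => -[n' [k' [j' []]]] /eqP.
by rewrite node_eq => /and3P[/eqP <- /eqP <- /eqP <-] /andP[_]; rewrite ltnNge Lj.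
Qed.

Lemma LP n k k' : (k < k')%N -> (L n k + 2 * M n <= P n k')%N.
Proof. by move=> kk; rewrite -PS P_mono. Qed.

Lemma not_active_eq0 i N : (0 < N)%N -> ~ active i -> pw N (e i) = 0.
Proof. by move=> N0 iA; apply: (@power_eq0 _ _ 1%N) => //; exact: T_inactive. Qed.

(** By induction on the block: the trunk takes at most [M n] steps, a branch [L n k], and the target
    a last [M n]; by [PS] and [MS] their total is at most [M n.+1]. *)
Lemma nilpotent n : nilpotent_below n.
Proof.
elim: n => [|n IH] i //; rewrite ltnS leq_eqVlt => /predU1P[ni|ni]; last first.
  by apply: power_eq0 (IH _ ni); apply: M_mono.
have [iA|iA] := EM (active i); last exact: not_active_eq0 (M_gt0 _) iA.
move: iA => [n' [[|k] [j [iE]]]]; rewrite iE block_node in ni *; rewrite {n'}ni in iE *.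
  move=> jM; have -> : e (node n 0 j) = trunk n (M n - (M n - j))%N.
    by rewrite /trunk (subKn (ltnW jM)) jM.
  have MM : (M n <= M n.+1)%N by apply: M_mono.
  rewrite trunk_out; [|lia..].
  rewrite big1// => i' _; rewrite /feed linear_sum big1// => k _.
  rewrite powerZ branch_nilpotent ?scaler0//.
  by have := LP n (ltn_ord k); rewrite MS; lia.
move=> /andP[kK jL]; apply: branch_nilpotent => //.
by have := LP n kK; rewrite MS; lia.
Qed.

(** Branch [k] is dead by this time by [branch_nilpotent], and a branch [k'] before it because
    [L n k' + M n <= P n k <= L n k]. Trunk nodes are excluded since they carry the main term. *)
Lemma kill_below n k i : (k < K n)%N -> below n k i ->
  (forall p, (p < M n)%N -> i != node n 0 p) -> pw (L n k + M n) (e i) = 0.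
Proof.
move=> kK ib iT; have M0 := M_gt0 n.
have [bi|bi] := ltnP (block i) n.
  by apply: power_eq0 (nilpotent bi); apply: leq_addl.
have [iA|iA] := EM (active i); last by apply: not_active_eq0 => //; lia.
move: iA ib => [n' [[|k'] [j [iE]]]]; rewrite iE /below block_node strand_node.
  rewrite iE block_node in bi; move=> jM; rewrite ltnNge bi /= => /andP[/eqP nn _].
  by rewrite nn in jM iE *; have := iT j jM; rewrite iE eqxx.
rewrite iE block_node in bi; move=> h; rewrite ltnNge bi /= => /andP[/eqP nn].
rewrite nn in h *; move: h => /andP[k'K jL]; rewrite ltnS leq_eqVlt => /predU1P[->|k'k].
  by apply: branch_nilpotent => //; exact: nilpotent.
apply: branch_nilpotent => //; first exact: nilpotent.
by have := LP n k'k; have := PL n k; lia.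
Qed.

(** With [u] the increment, [(1 + u) ^+ m * (1 - m * u) <= 1] by induction, and [t * u] is at most
    one half. *)
Lemma pow_rate_le2 N t : (0 < N)%N -> (t <= N)%N -> (1 + (2 * N%:R)^-1) ^+ t <= 2 :> R.
Proof.
move=> N0 tN; set u : R := (2 * N%:R)^-1.
have N0' : 0 < N%:R :> R by rewrite ltr0n.
have u0 : 0 < u by rewrite invr_gt0 mulr_gt0.
have key m : (m <= N)%N -> (1 + u) ^+ m * (1 - m%:R * u) <= 1.
  elim: m => [|m IH] mN; first by rewrite mul0r subr0 mulr1.
  apply: le_trans (IH (ltnW mN)); rewrite exprSr -mulrA ler_wpM2l//.
    by rewrite exprn_ge0// addr_ge0// ltW.
  rewrite -natr1; have : 0 <= m%:R * u ^+ 2 :> R by rewrite mulr_ge0// sqr_ge0.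
  by have := sqr_ge0 u; move: m%:R => r; nra.
have tu : t%:R * u <= 2^-1.
  by rewrite /u invfM mulrCA ler_piMr ?invr_ge0// ler_pdivrMr// mul1r ler_nat.
have := key t tN; have : 0 <= (1 + u) ^+ t by rewrite exprn_ge0// addr_ge0// ltW.
set X := (1 + u) ^+ t => X0 h.
have : X * 2^-1 <= X * (1 - t%:R * u) by rewrite ler_wpM2l//; lra.
lra.
Qed.

Lemma shift_above n k z : (forall i, below n k i -> z i = 0) ->
  forall i, below n k i -> S z i = 0.
Proof.
move=> z0 i; rewrite shiftE /shift_coord /below /block /strand.
case: (CodeSeq.decode i) => [|n' [|k' [|[|j] [|? ?]]]] //= ib.
by rewrite z0 ?mulr0// /below block_node strand_node.
Qed.

(** Every branch meeting the support of [z] has its [P] at least the arrival time [L n k + M n],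
    which bounds its rate; trunk weights are at most 1. *)
Lemma nrm_shift_above n k z : (k < K n)%N -> (forall i, below n k i -> z i = 0) ->
  nrm (S z) <= (1 + (2 * (L n k + M n)%:R)^-1) * nrm z.
Proof.
move=> kK z0; have N0 : (0 < L n k + M n)%N by have := M_gt0 n; lia.
have r1 : 1 <= 1 + (2 * (L n k + M n)%:R)^-1 :> R.
  by rewrite lerDl invr_ge0 mulr_ge0.
apply: nrm_shift; first exact: le_trans ler01 r1.
move=> n' k' j zn; have : ~~ below n k (node n' k' j).
  by apply: contra zn => /z0 ->.
rewrite /below block_node strand_node negb_or -leqNgt => /andP[nn' kk'].
rewrite /weight; case: k' zn kk' => [|k'] zn kk'; case: ifP => h; rewrite ?normr0 ?normr1//;
  try exact: le_trans ler01 r1.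
rewrite gtr0_norm ?rate_gt0//; apply: rate_le => //.
move: nn'; rewrite leq_eqVlt => /predU1P[nn'|nn'].
  move: kk'; rewrite nn' eqxx /= -ltnNge ltnS => kk'.
  by have := @LP n' _ _ kk'; lia.
have := M_le_P n' k'; have := M_mono nn'; have := LP n kK; rewrite MS; lia.
Qed.

(** Up to time [N] the pure shift enlarges [z] at most twice. The powers of [T] deviate from it only
    through [U], which is tiny on these coordinates, and this costs at most one more [nrm z]. *)
Lemma nrm_above n k z : (k < K n)%N -> (forall i, below n k i -> z i = 0) ->
  nrm (pw (L n k + M n) z) <= 3 * nrm z.
Proof.
move=> kK z0; set N := (L n k + M n)%N.
have N0 : (0 < N)%N by rewrite /N; have := M_gt0 n; lia.
have Sz t : forall i, below n k i -> power S t z i = 0.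
  elim: t => // t IH; rewrite powerS; exact: shift_above.
have nS t : (t <= N)%N -> nrm (power S t z) <= 2 * nrm z.
  move=> tN; apply: le_trans (ler_wpM2r (nrm_ge0 z) (pow_rate_le2 N0 tN)).
  elim: t {tN} => [|t IH]; first by rewrite mul1r.
  rewrite powerS exprS -mulrA; apply: le_trans (nrm_shift_above kK (Sz t)) _.
  by rewrite ler_wpM2l// addr_ge0// invr_ge0 mulr_ge0.
pose d : R := 64^-1 ^+ P n k.+1 * (2 * nrm z).
have d0 : 0 <= d by rewrite !mulr_ge0 ?nrm_ge0 ?exprn_ge0 ?invr_ge0.
(* The error is multiplied by at most 4 at each step and gains at most [d] from [U] acting on the
   shifted vector. *)
have err t : (t <= N)%N -> nrm (pw t z - power S t z) <= (4 ^+ t - 1) * d.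
  elim: t => [|t IH] tN; first by rewrite !subrr nrm0 mul0r.
  rewrite !powerS.
  have -> : T (pw t z) - S (power S t z) =
      T (pw t z - power S t z) + U (power S t z).
    by rewrite linearB [T (power S t z)]operatorE opprD addrA addrNK.
  apply: le_trans (nrmD _ _) _.
  have h1 := nrm_operator (pw t z - power S t z).
  have h2 := nrm_U_above kK (Sz t).
  have h3 : 64^-1 ^+ P n k.+1 * nrm (power S t z) <= d.
    by rewrite /d ler_wpM2l ?exprn_ge0 ?invr_ge0// nS// ltnW.
  by have := IH (ltnW tN); rewrite exprS; move: (4 ^+ t) => X; nra.
have small : (4 ^+ N - 1) * d <= nrm z.
  have NP : (N < P n k.+1)%N by rewrite PS /N; have := M_gt0 n; lia.
  have : 4 ^+ N * d <= nrm z.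
    rewrite /d !mulrA ler_piMl ?nrm_ge0//.
    have P0' : (P n k.+1 = (P n k.+1).-1.+1)%N by lia.
    apply: (@le_trans _ _ (4 ^+ (P n k.+1) * 64^-1 ^+ P n k.+1 * 2)).
      rewrite ler_wpM2r// ler_wpM2r ?exprn_ge0 ?invr_ge0//.
      by rewrite ler_eXn2l ?ltr1n// ltnW.
    rewrite -exprMn P0' exprS (_ : 4 * 64^-1 = 16^-1 :> R); last by field.
    have : 16^-1 ^+ (P n k.+1).-1 <= 1 :> R by rewrite exprn_ile1 ?invr_ge0 ?invf_le1 ?ler1n.
    move: (_ ^+ _) => X; lra.
  by move=> h; rewrite mulrBl mul1r; lra.
have := err N (leqnn N); have := nS N (leqnn N).
have := nrm_sub_trans (power S N z) (pw N z) 0; rewrite !subr0.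
move: small; lra.
Qed.

(** In [trunk_out], branch [k] has delivered its target with [r + i] powers of [T] left over, and
    earlier branches are dead. For later branches the crude growth bound times their tiny feed
    suffices. *)
Lemma trunk_power n k r : (k < K n)%N -> (r < M n)%N ->
  nrm (pw (L n k + M n) (e (node n 0 r)) -
       \sum_(i < M n - r) q n k i *: pw (r + i) (Y n k)) <=
  4 ^+ (L n k + M n) * (2^-1 ^+ n.+1 * 64^-1 ^+ P n k.+1).
Proof.
move=> kK rM.
have -> : e (node n 0 r) = trunk n (M n - (M n - r))%N.
  by rewrite /trunk (subKn (ltnW rM)) rM.
rewrite trunk_out; [|lia..].
rewrite -sumrB.
have term (i : 'I_(M n - r)) :
    pw (L n k + M n - (M n - r) + i) (feed n (M n - i.+1)) - q n k i *: pw (r + i) (Y n k) =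
    \sum_(k' < K n | (k < k')%N)
      ((c n k')%:C * q n k' i) *: pw (L n k + (r + i)) (e (node n k'.+1 0)).
  have iM := ltn_ord i.
  rewrite (_ : (L n k + M n - (M n - r) + i = L n k + (r + i))%N); last by lia.
  rewrite /feed (_ : (M n - (M n - i.+1).+1 = i)%N); last by lia.
  rewrite linear_sum (bigID (fun k' : 'I_(K n) => (k < k')%N))/=.
  rewrite [X in _ + X - _](bigD1 (Ordinal kK))/=; last by rewrite ltnn.
  rewrite [X in _ + (_ + X) - _]big1 ?addr0 => [|k']; last first.
    rewrite -leqNgt => /andP[k'k /eqP kne]; have k'k' : (k' < k)%N.
      rewrite ltn_neqAle k'k andbT; apply/eqP => kE; apply: kne; exact: val_inj.
    rewrite powerZ branch_nilpotent ?scaler0//; first exact: nilpotent.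
    have := LP n k'k'; have := PL n k; lia.
  rewrite [X in _ + X - _]powerZ addnC powerD branch_full// powerZ scalerA.
  rewrite mulrAC -rmorphM/= mulfV ?gt_eqF// mul1r addrK.
  by apply: eq_bigr => k' _; rewrite powerZ addnC.
under eq_bigr => i _ do rewrite term.
apply: le_trans (nrm_sum _ _ _) _.
apply: (@le_trans _ _ (\sum_(i < M n - r) \sum_(k' < K n | (k < k')%N)
    4 ^+ (L n k + M n) * (c n k' * cmod (q n k' i)))).
  apply: ler_sum => i _; apply: le_trans (nrm_sum _ _ _) _; apply: ler_sum => k' _.
  rewrite nrm_scale cmodM cmod_real gtr0_norm// mulrC ler_wpM2r//.
    by rewrite mulr_ge0 ?cmod_ge0// ltW.
  apply: le_trans (nrm_pw _ _) _; rewrite nrm_basis mulr1 ler_eXn2l ?ltr1n//.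
  by have := ltn_ord i; lia.
rewrite exchange_big/=; under eq_bigr => k' _ do rewrite -mulr_sumr -mulr_sumr.
rewrite -mulr_sumr ler_wpM2l ?exprn_ge0//.
apply: le_trans (sum_tau n k.+1); apply: ler_sum => k' _.
apply: le_trans (_ : tau n k' <= _); last by have := tau_ge0 n k'; lra.
apply: le_trans (feed_le n k'); rewrite ler_pM2l//.
rewrite (big_ord_widen (M n) (fun i => cmod (q n k' i)) (leq_subr r (M n))).
rewrite [leRHS](bigID (fun i : 'I_(M n) => (i < M n - r)%N))/= lerDl.
by apply: sumr_ge0 => i _; exact: cmod_ge0.
Qed.

Lemma trunk_total n k x : (k < K n)%N ->
  nrm (pw (L n k + M n) (\sum_(r < M n) x (node n 0 r) *: e (node n 0 r)) -
       \sum_(r < M n) \sum_(i < M n - r) (x (node n 0 r) * q n k i) *: pw (r + i) (Y n k)) <=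
  2^-1 ^+ n * nrm x.
Proof.
move=> kK; rewrite linear_sum -sumrB.
apply: le_trans (nrm_sum _ _ _) _.
apply: (@le_trans _ _ (\sum_(r < M n) nrm x *
    (4 ^+ (L n k + M n) * (2^-1 ^+ n.+1 * 64^-1 ^+ P n k.+1)))).
  apply: ler_sum => r _.
  have -> : pw (L n k + M n) (x (node n 0 r) *: e (node n 0 r)) -
       \sum_(i < M n - r) (x (node n 0 r) * q n k i) *: pw (r + i) (Y n k) =
      x (node n 0 r) *: (pw (L n k + M n) (e (node n 0 r)) -
       \sum_(i < M n - r) q n k i *: pw (r + i) (Y n k)).
    rewrite powerZ scalerBr scaler_sumr; congr (_ - _).
    by apply: eq_bigr => i _; rewrite scalerA.
  rewrite nrm_scale; apply: ler_pM; rewrite ?cmod_ge0 ?nrm_ge0 ?cmod_coord_le//.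
  exact: trunk_power.
rewrite sumr_const card_ord -mulrnAr mulrC ler_wpM2r ?nrm_ge0//.
rewrite -mulr_natl.
have M4 : (M n)%:R <= 4 ^+ M n :> R.
  by rewrite -natrX ler_nat ltnW// ltn_expl.
set h : R := 2^-1 ^+ n; have h0 : 0 <= h by rewrite exprn_ge0// invr_ge0.
(* The number of trunk nodes is absorbed by [4 ^+ M n]; by [PS] the exponents of 4 then add up to
   [P n k.+1], the exponent of [64^-1]. *)
have small : (M n)%:R * 4 ^+ (L n k + M n) * 64^-1 ^+ P n k.+1 <= 1 :> R.
  apply: (@le_trans _ _ (4 ^+ P n k.+1 * 64^-1 ^+ P n k.+1)).
    rewrite ler_wpM2r ?exprn_ge0 ?invr_ge0//.
    rewrite PS (_ : L n k + 2 * M n = M n + (L n k + M n))%N; last by lia.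
    by rewrite (exprD _ (M n) (L n k + M n)) ler_wpM2r ?exprn_ge0.
  rewrite -exprMn exprn_ile1 ?mulr_ge0 ?invr_ge0//.
  by rewrite ler_pdivrMr// mul1r ler_nat.
rewrite exprS -/h; move: small.
move: (4 ^+ _) (64^-1 ^+ _) => X Z small.
rewrite (_ : _ * _ = h * (2^-1 * ((M n)%:R * X * Z))); last by ring.
rewrite ler_piMr// -ler_pdivlMl ?invr_gt0// invrK mulr1.
by apply: le_trans small _; rewrite ler1n.
Qed.

(** Split [x] into its trunk part, the rest below branch [k], which is dead, and the part above,
    which at most triples. The double sum is the product of the trunk polynomial and [q n k],
    truncated below degree [M n], applied to [Y n k]. *)
Lemma orbit_estimate n k x : (k < K n)%N ->
  nrm (pw (L n k + M n) x -
       \sum_(r < M n) \sum_(i < M n - r) (x (node n 0 r) * q n k i) *: pw (r + i) (Y n k)) <=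
  2^-1 ^+ n * nrm x + 3 * nrm (restrict (fun i => (n <= i)%N) x).
Proof.
move=> kK.
pose on_trunk i := has (fun p => i == node n 0 p) (iota 0 (M n)).
pose z := restrict (fun i => ~~ below n k i) x.
pose y := restrict (fun i => below n k i && ~~ on_trunk i) x.
pose t := \sum_(r < M n) x (node n 0 r) *: e (node n 0 r).
have xE : x = y + t + z.
  apply: l2P => i; rewrite !l2D !restrictE.
  rewrite (sum_basis_coord _ (fun r => x (node n 0 r)) (fun r => node n 0 r)).
  case: (boolP (on_trunk i)) => [/hasP[p]|it].
    rewrite mem_iota /= add0n => pM /eqP iE.
    rewrite andbF add0r iE /below block_node strand_node eqxx orbT addr0.
    rewrite (bigD1 (Ordinal pM))//= eqxx mulr1 big1 ?addr0// => p' p'p.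
    rewrite node_eq !eqxx/=; case: eqP => [pE|]; rewrite ?mulr0//.
    by case/eqP: p'p; exact: val_inj.
  rewrite andbT big1 ?addr0 => [|p _]; first by case: ifP => _; rewrite ?addr0 ?add0r.
  case: eqP => [iE|]; rewrite ?mulr0//.
  case/negP: it; apply/hasP; exists (p : nat); last exact/eqP.
  by rewrite mem_iota /= add0n.
have y0 : pw (L n k + M n) y = 0.
  apply: vanish_restrict (nrm_pw _) _ => i /andP[ib it]; apply: kill_below => // p pM.
  by apply: contra it => /eqP ->; apply/hasP; exists p; rewrite ?eqxx// mem_iota.
have z0 : nrm (pw (L n k + M n) z) <= 3 * nrm (restrict (fun i => (n <= i)%N) x).
  apply: le_trans (nrm_above kK _) _.
    by move=> i ib; rewrite restrictE ib.
  rewrite ler_pM2l//; apply: nrm_restrict_sub => i; rewrite negb_or -leqNgt.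
  by move=> /andP[/leq_trans ni _]; exact/ni/block_le.
rewrite {1}xE !linearD y0 add0r addrAC.
apply: le_trans (nrmD _ _) (lerD _ z0).
exact: trunk_total.
Qed.

End Junctions.

Lemma tree_operator : exists T : {linear H -> H},
  (forall x, nrm (T x) <= 4 * nrm x) /\
  forall n k x, (k < K n)%N ->
    nrm (power T (L n k + M n) x -
         \sum_(r < M n) \sum_(i < M n - r)
           (x (node n 0 r) * q n k i) *: power T (r + i) (Y n k)) <=
    2^-1 ^+ n * nrm x + 3 * nrm (restrict (fun i => (n <= i)%N) x).
Proof.
have [U U_lim] := operator_limit junctions_step.
rewrite mulr1 in U_lim.
exists (operator U); split=> [x|n k x]; first exact: nrm_operator.
exact: orbit_estimate.
Qed.

End Tree.

(** * Choice of the parameters and hypercyclicity *)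

Section Instantiation.
Variable R : realType.
Local Notation C := R[i].
Local Notation H := (l2 R).
Implicit Types x y z : H.

(** Collecting terms by total degree turns the main term into a polynomial in [T] whose coefficients
    are those controlled by [inverse_net]. *)
Lemma triangle_sum (V : zmodType) (G : nat -> nat -> V) m :
  \sum_(r < m) \sum_(i < m - r) G r i =
  \sum_(l < m) \sum_(i < l.+1) G (l - i)%N i.
Proof.
elim: m => [|m IH]; first by rewrite !big_ord0.
rewrite [RHS]big_ord_recr /= -IH.
rewrite [X in _ = _ + X](reindex_inj rev_ord_inj) /=.
rewrite [X in _ = _ + X]big_ord_recr /= [LHS]big_ord_recr /=.
rewrite !subSnn subSS subnn !subn0 big_ord_recr big_ord0 /= add0r addrA; congr (_ + _).
rewrite -big_split; apply: eq_bigr => r _.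
have rm := ltn_ord r.
rewrite (subSn (ltnW rm)) big_ord_recr /= subSS; congr (_ + G _ _).
by rewrite subKn// ltnW.
Qed.

Lemma power_unbounded (r X : R) : 1 < r ->
  exists l0, forall l, (l0 <= l)%N -> X <= r ^+ l.
Proof.
move=> r1; have u0 : 0 < r - 1 by rewrite subr_gt0.
have bern l : 1 + l%:R * (r - 1) <= r ^+ l.
  elim: l => [|l IH]; first by rewrite mul0r addr0.
  rewrite exprS -natr1; have : 0 <= l%:R * (r - 1) ^+ 2 by rewrite mulr_ge0// sqr_ge0.
  have := ler_wpM2l (ltW (lt_trans ltr01 r1)) IH.
  by move: (r ^+ l) (l%:R) => A B; nra.
exists (Num.truncn (`|X| / (r - 1))).+1 => l ll.
apply: le_trans (bern l); apply: le_trans (ler_norm X) _.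
have : `|X| / (r - 1) < l%:R.
  by apply: lt_le_trans (truncnS_gt _) _; rewrite ler_nat.
by rewrite ltr_pdivrMr//; move: (l%:R * _) => A; lra.
Qed.

(** In block [n], each pair of an index [m < n] in the dense sequence and a net polynomial gets its
    own branch. When the first trunk coordinate is large, one of these branches brings the orbit
    close to [d m]. *)
Lemma exists_hypercyclic : exists T : {linear H -> H},
  (forall x, nrm (T x) <= 4 * nrm x) /\
  forall x, (forall n0, exists2 n, (n0 <= n)%N & 8^-1 ^+ n < cmod (x (node n 0 0))) ->
  forall y (e : R), 0 < e -> exists N, nrm (y - power T N x) < e.
Proof.
have [d [sz [d_sz d_dense]]] := dense_finite_sequence R.
(* A vector not yet supported in the earlier blocks is replaced by 0; [d m] itself is the target
   once [sz m <= n]. *)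
pose target n m : H := if (sz m <= n)%N then d m else 0.
(* Small enough that [Mv] coefficient errors, each multiplied by at most [4 ^+ Mv * nrm (d m)] with
   [m < n], add up to at most [2^-1 ^+ n]. *)
pose eps n Mv : R := 2^-1 ^+ n / (Mv.+1%:R * 4 ^+ Mv * (1 + \sum_(m < n) nrm (d m))).
have eps_gt0 n Mv : 0 < eps n Mv.
  rewrite divr_gt0 ?exprn_gt0 ?invr_gt0// !mulr_gt0 ?exprn_gt0//.
  by rewrite ltr_pwDl// sumr_ge0// => i _; exact: nrm_ge0.
(* The coefficient bound is [n] itself, so one net per block serves every [x] as soon as [n] exceeds
   its norm. *)
have /choice[net netP] : forall p : nat * nat, exists NQ : nat * (nat -> nat -> C),
    forall a : nat -> C, 8^-1 ^+ p.1 <= cmod (a 0%N) ->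
    (forall i, cmod (a i) <= p.1%:R) ->
    exists2 j, (j < NQ.1)%N & forall l, (l < p.2)%N ->
      cmod (\sum_(i < l.+1) a (l - i)%N * NQ.2 j i - (l == 0%N)%:R) <= eps p.1 p.2.
  move=> [n Mv]; have s0 : 0 < 8^-1 ^+ n :> R by rewrite exprn_gt0// invr_gt0.
  have [N [Q QP]] := @inverse_net R Mv _ n%:R _ s0 (eps_gt0 n Mv).
  by exists (N, Q).
(* A branch number encodes a pair by division with remainder: the quotient selects the target and
   the remainder the polynomial. *)
pose Kf n Mv := (n * (net (n, Mv)).1)%N.
pose qf n Mv k i := (net (n, Mv)).2 (k %% (net (n, Mv)).1)%N i.
pose Yf n Mv k := target n (k %/ (net (n, Mv)).1)%N.
pose tf n k p : R := 2^-1 ^+ (n + k + 3) * 64^-1 ^+ p.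
pose cf n Mv k p : R := tf n k p / (1 + \sum_(i < Mv) cmod (qf n Mv k i)).
have tf_gt0 n k p : 0 < tf n k p by rewrite mulr_gt0// exprn_gt0// invr_gt0.
have sum_ge0 n Mv k : 0 <= \sum_(i < Mv) cmod (qf n Mv k i).
  by rewrite sumr_ge0// => i _; exact: cmod_ge0.
have cf_gt0 n Mv k p : 0 < cf n Mv k p by rewrite divr_gt0// ltr_pwDl.
(* Positivity of [p] matters: at [p = 0] the inverse is 0 by convention and the rate would be 1,
   without growth. *)
have /choice[Lf LfP] : forall p : nat * nat * nat * nat, exists l, (0 < p.2)%N ->
    let: (n, Mv, k, p) := p in (p <= l)%N /\
    nrm (Yf n Mv k) <= tf n k p * (cf n Mv k p * (1 + (2 * p%:R)^-1) ^+ l.-1).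
  move=> [[[n Mv] k] [|p]]; first by exists 0%N.
  have r1 : 1 < 1 + (2 * p.+1%:R)^-1 :> R by rewrite ltrDl invr_gt0 mulr_gt0.
  have [l0 lP] := power_unbounded (nrm (Yf n Mv k) / (tf n k p.+1 * cf n Mv k p.+1)) r1.
  exists (maxn l0 p.+1).+1 => _; split; first by rewrite leqW// leq_maxr.
  have := lP _ (leq_maxl l0 p.+1); rewrite ler_pdivrMr; last exact: mulr_gt0.
  by rewrite mulrA [leRHS]mulrC.
(* The branches of a block are built in turn from its trunk length, and the last bound becomes the
   next trunk length. Hence the data above are given for an arbitrary trunk length [Mv]. *)
pose Pk n Mv := fix Pk k := if k is k'.+1 then (Lf (n, Mv, k', Pk k') + 2 * Mv)%N else Mv.
pose M := fix M n := if n is n'.+1 then Pk n' (M n') (Kf n' (M n')) else 1%N.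
have Pk_ge n Mv k : (Mv <= Pk n Mv k)%N by case: k => [|k] //=; lia.
have M_gt0 n : (0 < M n)%N.
  by elim: n => //= n IH; apply: leq_trans IH (Pk_ge _ _ _).
pose P n k := Pk n (M n) k.
pose K n := Kf n (M n).
pose L n k := Lf (n, M n, k, P n k).
pose c n k := cf n (M n) k (P n k).
pose q n k i := qf n (M n) k i.
pose Y n k := Yf n (M n) k.
have P_gt0 n k : (0 < P n k)%N by apply: leq_trans (M_gt0 n) (Pk_ge _ _ _).
have P0 n : P n 0 = M n by [].
have PS n k : P n k.+1 = (L n k + 2 * M n)%N by [].
have MS n : M n.+1 = P n (K n) by [].
have PL n k : (P n k <= L n k)%N.
  by have [] := LfP (n, M n, k, P n k) (P_gt0 n k).
have c_gt0 n k : 0 < c n k by exact: cf_gt0.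
have feed_le n k : c n k * \sum_(i < M n) cmod (q n k i) <= tau R P n k.
  rewrite /c /cf -/(tf n k (P n k)) -[tau _ _ _ _]/(tf n k (P n k)).
  have s0 := sum_ge0 n (M n) k; rewrite mulrAC ler_pdivrMr ?ltr_pwDl//.
  by rewrite ler_pM2l// lerDr.
have Y_block n k i : (n <= block i)%N -> Y n k i = 0.
  move=> ni; rewrite /Y /Yf /target; case: ifP => szn; last by rewrite l20.
  by apply: d_sz; apply: leq_trans szn (leq_trans ni (block_le i)).
have Y_le n k : nrm (Y n k) <= tau R P n k * (c n k * rate R P n k ^+ (L n k).-1).
  by have [] := LfP (n, M n, k, P n k) (P_gt0 n k).
have [T [T4 T_orbit]] := @tree_operator R M K L P c q Y
  M_gt0 P0 PS MS PL c_gt0 feed_le Y_block Y_le.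
exists T; split=> //.
move=> x x_often y e e0.
have e2 : 0 < e / 2 by rewrite divr_gt0.
have [m ym] := d_dense y _ e2.
(* Error budget: three times the tail contributes [e / 8], the terms of order [2^-1 ^+ n] another
   [e / 8], and the choice of [d m] less than [e / 2]. *)
have e24 : 0 < e / 24 by rewrite divr_gt0.
have [t0 tP] := nrm_tail x e24.
have half1 : 1 < 2 :> R by rewrite ltr1n.
have [l0 lP] := power_unbounded (8 * (1 + nrm x) / e) half1.
have [n nn xn] := x_often (maxn (maxn m.+1 (sz m)) (maxn (maxn t0 l0) (Num.truncn (nrm x)).+1)).
move: nn; rewrite !geq_max => /andP[/andP[mn szn] /andP[/andP[t0n l0n] xtn]].
have [j jN jP] : exists2 j, (j < (net (n, M n)).1)%N & forall l, (l < M n)%N ->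
    cmod (\sum_(i < l.+1) x (node n 0 (l - i)) * (net (n, M n)).2 j i - (l == 0%N)%:R)
      <= eps n (M n).
  apply: (netP (n, M n) (fun i => x (node n 0 i))); first exact: ltW.
  move=> i; apply: le_trans (cmod_coord_le _ _) _; apply: ltW.
  by apply: lt_le_trans (truncnS_gt _) _; rewrite ler_nat.
pose k := (m * (net (n, M n)).1 + j)%N.
have kK : (k < K n)%N.
  rewrite /K /Kf /k; apply: (@leq_trans (m.+1 * (net (n, M n)).1)).
    by rewrite mulSn addnC ltn_add2r.
  by rewrite leq_mul2r mn orbT.
have net0 : (0 < (net (n, M n)).1)%N by apply: leq_ltn_trans jN.
have kd : (k %/ (net (n, M n)).1 = m)%N by rewrite /k divnMDl// divn_small// addn0.
have km : (k %% (net (n, M n)).1 = j)%N by rewrite /k modnMDl modn_small.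
have YE : Y n k = d m by rewrite /Y /Yf kd /target szn.
have := T_orbit n k x kK; rewrite YE.
rewrite (triangle_sum (fun r i => (x (node n 0 r) * q n k i) *: power T (r + i) (d m))).
set main := \sum_(l < M n) _ => est.
have mainE : main = \sum_(l < M n) (\sum_(i < l.+1) x (node n 0 (l - i)) *
    (net (n, M n)).2 j i) *: power T l (d m).
  apply: eq_bigr => l _; rewrite scaler_suml; apply: eq_bigr => i _.
  by rewrite subnK ?/q ?/qf ?km//; have := ltn_ord i; rewrite ltnS.
(* The constant polynomial 1 applied to [d m], written to the same length as [main] for a
   coefficientwise comparison. *)
have dE : d m = \sum_(l < M n) ((l == 0%N :> nat)%:R : C) *: power T l (d m).
  rewrite (bigD1 (Ordinal (M_gt0 n)) isT) big1 => [|l l0'].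
    by rewrite scale1r; exact: esym (addr0 _).
  case: eqP => [l0''|]; rewrite ?scale0r//.
  by case/eqP: l0'; exact: val_inj.
have main_d : nrm (main - d m) <= 2^-1 ^+ n.
  rewrite mainE [X in nrm (_ - X)]dE -sumrB.
  apply: le_trans (nrm_sum _ _ _) _.
  apply: (@le_trans _ _ (\sum_(l < M n) eps n (M n) * (4 ^+ M n * nrm (d m)))).
    apply: ler_sum => l _; rewrite -scalerBl nrm_scale.
    apply: ler_pM; rewrite ?cmod_ge0 ?nrm_ge0//; first exact: jP.
    apply: le_trans (nrm_power _ _ T4 _) _ => //.
    by rewrite ler_wpM2r ?nrm_ge0// ler_eXn2l ?ltr1n// ltnW.
  rewrite sumr_const card_ord -[leLHS]mulr_natl /eps.
  have dm : nrm (d m) <= 1 + \sum_(m < n) nrm (d m).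
    rewrite (bigD1 (Ordinal mn))//= addrCA lerDl addr_ge0// sumr_ge0// => i _.
    exact: nrm_ge0.
  have D0 : 0 < (M n).+1%:R * 4 ^+ M n * (1 + \sum_(m < n) nrm (d m)).
    rewrite !mulr_gt0 ?exprn_gt0// ltr_pwDl// sumr_ge0// => i _; exact: nrm_ge0.
  rewrite mulrCA mulrAC -!mulrA ler_piMr ?exprn_ge0 ?invr_ge0//.
  rewrite !mulrA mulrC ler_pdivrMl// mulr1.
  apply: ler_pM; rewrite ?mulr_ge0 ?nrm_ge0 ?exprn_ge0//.
  by rewrite ler_wpM2r ?exprn_ge0// ler_nat.
exists (L n k + M n)%N.
have h2 : 2^-1 ^+ n * (1 + nrm x) <= e / 8.
  have := lP _ l0n; rewrite ler_pdivrMr// => h.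
  by rewrite exprVn mulrC ler_pdivrMr ?exprn_gt0// mulrAC ler_pdivlMr// mulrC (mulrC e).
have := tP _ t0n => tail.
apply: le_lt_trans (nrm_sub_trans (d m) y _) _; rewrite (splitr e).
apply: ltr_leD ym _; apply: le_trans (nrm_sub_trans main (d m) _) _.
rewrite (nrmC (d m) main) (nrmC main (power _ _ _)).
apply: le_trans (lerD main_d est) _; rewrite addrA -[X in X + 2^-1 ^+ n * _]mulr1 -mulrDr.
apply: le_trans (lerD h2 (ler_wpM2l (ler0n R 3) tail)) _.
by rewrite (_ : _ + _ = e / 4); [rewrite ler_pM2l// lef_pV2 ?posrE// ler_nat|field].
Qed.

End Instantiation.

(** * Assembly: hypercyclicity of non-negligible vectors combined with the spreading unitary *)

Lemma bounded_operator_l2 (R : realType) (T : {linear l2_hilbert R -> l2_hilbert R}) (c : R) :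
  (forall x : l2 R, nrm (T x) <= c * nrm x) -> bounded_operator T.
Proof.
move=> Tc; exists c%:C => x; have := Tc x.
by rewrite -lecR rmorphM/= => h; exact: h.
Qed.

Theorem theorem1p1 (R : realType) :
  exists H : hilbertSpace R,
    separable H /\ ~ finite_dimensional H /\
    exists T V : {linear H -> H},
      bounded_operator T /\ unitary_operator V /\
      forall x : H, x <> 0 ->
        dense (orbit_of T x) \/ dense (orbit_of T (V x)).
Proof.
exists (l2_hilbert R); split; first exact: l2_separable.
split; first exact: l2_infinite_dimensional.
have [T [T4 Torb]] := exists_hypercyclic R.
pose sg n := node n 0 0.
have sg_gt i : (i < sg i)%N by have /andP[] := CodeSeq.ltn_code [:: i; 0%N; 0%N].
have sg_inj : injective sg.
  by move=> i j /eqP; rewrite node_eq => /and3P[/eqP].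
(* [block] serves as the choice of mixed coordinates: [node k n 0] lies in block [k] and is at least
   [n], so every value recurs arbitrarily late. *)
have often k n : exists2 i, (n <= i)%N & block i = k.
  exists (node k n 0); last exact: block_node.
  by have /and3P[_ /ltnW] := CodeSeq.ltn_code [:: k; n; 0%N].
have [V [W [[c Vc] VW WK VK spread]]] := unitary_spread R block_le sg_gt sg_inj often.
exists T, V; split; first exact: bounded_operator_l2 T4.
split.
  split; first exact: bounded_operator_l2 Vc.
  by exists W; split.
have orb (x : l2 R) : ~ negligible sg x -> dense (orbit_of T x : set (l2_hilbert R)).
  move=> xN; apply: dense_l2 => y e e0.
  have [n0|N yN] := Torb x _ y e e0; last first.
    by exists (power T N x) => //; exists N => //; rewrite power_iter.
  apply: contrapT => h; apply: xN; exists n0 => n n0n.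
  by rewrite leNgt; apply/negP => xn; apply: h; exists n.
move=> x x0; have [xN|xN] := pselect (negligible sg x); last by left; exact: orb.
have [VxN|VxN] := pselect (negligible sg (V x)); last by right; exact: orb.
by case: x0; exact: spread.
Qed.
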